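(* Let $f=\Phi(\omega;t)\in\check X_A$, where $\omega\in\mathbb{C}^n$ and $t\in\mathbb{C}^m_B$. Then the Hessian matrix $H_f(w)$ is singular at $w=-\omega$ if and only if $P_A(t)=0$. In particular, if $\check X_A$ is a hypersurface and $f$ is a smooth point on $\check X_A$, then the Hessian matrix $H_f(-\omega)$ is nonsingular.
   Context: Setting. Let $n\ge1$ and let $A=(\alpha_1,\dots,\alpha_N)$ be a real $(1+n)\times N$ matrix (a point configuration; columns need not be distinct) of rank $1+n$ whose top row is the all ones vector. Let $m=N-n-1\ge 1$. Let $\hat A$ be the $n\times N$ matrix obtained by deleting the top row of $A$, with columns $\hat\alpha_1,\dots,\hat\alpha_N$. A Gale dual of $A$ is an $N\times m$ matrix $B$ of rank $m$ with $AB=0$ (its columns form a basis of $\ker A$); fix one, with rows $\beta_1,\dots,\beta_N$, and write $\langle\beta,t\rangle=\sum_i\beta_it_i$ for $t\in\mathbb{C}^m$. Put $\mathbb{C}^m_B=\{t\in\mathbb{C}^m:\langle\beta_k,t\rangle\ne0 \text{ for all } k\}$. Cuspidal form. With $\Sigma$ the set of $n$-element subsets $\sigma\subset\{1,\dots,N\}$ and $|\hat A_\sigma|$ the determinant of the $n\times n$ submatrix of $\hat A$ with columns in $\sigma$, $$P_A(t)=\sum_{\sigma\in\Sigma}|\hat A_\sigma|^2\prod_{k\in\sigma}\langle\beta_k,t\rangle .$$ Discriminant variety and parametrization. $(\mathbb{C}^\times)^A$ denotes the family of exponential sums $f(w_0,w)=\sum_k c_k e^{w_0+\langle w,\hat\alpha_k\rangle}$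 with $c_k\in\mathbb{C}^\times$, $(w_0,w)\in\mathbb{C}\times\mathbb{C}^n$, identified with $(c_1,\dots,c_N)$. $\check X_A\subset(\mathbb{C}^\times)^A$ is the set of $f$ having a singular point (a point where $f$ and all its first partial derivatives vanish). The (dehomogenized, $\omega_0=1$) Horn–Kapranov parametrization is $\Phi:\mathbb{C}^n\times\mathbb{C}^m_B\to\check X_A$, $\Phi(\omega;t)=\big(e^{1+\langle\omega,\hat\alpha_k\rangle}\langle\beta_k,t\rangle\big)_{k=1}^N$; the exponential sum $\Phi(\omega;t)$ has a singular point at $(w_0,w)=(-1,-\omega)$. $H_f(w)$ denotes the $n\times n$ matrix of second partial derivatives of $f$ with respect to $w_1,\dots,w_n$, evaluated at $(w_0,w)=(-1,w)$. $\check X_A$ is a hypersurface if it has codimension one, i.e. contains a locally closed complex submanifold of $(\mathbb{C}^\times)^A$ of dimension $N-1$; a smooth point is a point near which $\check X_A$ is a complex submanifold of codimension one. *)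

(* Defs.v *)
From HB Require Import structures.
From mathcomp Require Import all_boot all_order all_algebra.
From mathcomp Require Import all_classical all_reals all_analysis.
From mathcomp Require Export complex.
Set Implicit Arguments.
Unset Strict Implicit.
Unset Printing Implicit Defensive.
Import Order.TTheory GRing.Theory Num.Theory.
Import numFieldNormedType.Exports.
Local Open Scope classical_set_scope.
Local Open Scope ring_scope.
Local Open Scope complex_scope.

(* numFieldNormedType equips abstract numeric fields with the topology of the
   absolute value; these instances make it available on R[i] itself, so that
   'D_v and differentiable below are complex derivatives. *)
HB.instance Definition _ (R : rcfType) := GRing.ComAlgebra.copy R[i] R[i]^o.
HB.instance Definition _ (R : rcfType) := Vector.copy R[i] R[i]^o.
HB.instance Definition _ (R : rcfType) := NormedModule.copy R[i] R[i]^o.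

Definition expC (R : realType) (z : R[i]) : R[i] :=
  (expR (complex.Re z))%:C * (cos (complex.Im z) +i* sin (complex.Im z)).

Section Configuration.
Variables (R : realType) (n N m : nat).
Implicit Types (A : 'M[R]_(1 + n, N)) (B : 'M[R]_(N, m)).

Definition point_configuration A := \rank A = (1 + n)%N /\ usubmx A = const_mx 1.

Definition Ahat A : 'M[R]_(n, N) := dsubmx A.

Definition gale_dual A B := \rank B = m /\ A *m B = 0.

Definition gale_form B (k : 'I_N) (t : 'rV[R[i]]_m) : R[i] :=
  \sum_(i < m) (B k i)%:C * t 0 i.

(* the complement C^m_B of the hyperplanes <beta_k, t> = 0 *)
Definition gale_complement B : set 'rV[R[i]]_m :=
  [set t : 'rV[R[i]]_m | forall k, gale_form B k t != 0].

Definition alpha_form A (k : 'I_N) (w : 'rV[R[i]]_n) : R[i] :=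
  \sum_(j < n) w 0 j * (Ahat A j k)%:C.

(* The columns are taken in increasing order. When #|sigma| = n, conform_mx
   only casts 'M_(n, #|sigma|) to 'M_n; otherwise its value is the dummy 0. *)
Definition maximal_minor A (sigma : {set 'I_N}) : R :=
  \det (conform_mx (0 : 'M[R]_n)
          (colsub (fun j : 'I_#|sigma| => enum_val j) (Ahat A))).

Definition cuspidal_form A B (t : 'rV[R[i]]_m) : R[i] :=
  \sum_(sigma : {set 'I_N} | #|sigma| == n)
     (maximal_minor A sigma ^+ 2)%:C * \prod_(k in sigma) gale_form B k t.

(* An exponential sum is identified with its row of coefficients c. *)
Definition expsum A (c : 'rV[R[i]]_N) (w0 : R[i]) (w : 'rV[R[i]]_n) : R[i] :=
  \sum_(k < N) c 0 k * expC (w0 + alpha_form A k w).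

Definition singular_point A (c : 'rV[R[i]]_N) (w0 : R[i]) (w : 'rV[R[i]]_n) :=
  [/\ expsum A c w0 w = 0,
      'D_1 (fun s : R[i] => expsum A c s w) w0 = 0
    & forall j : 'I_n, 'D_(delta_mx 0 j) (expsum A c w0) w = 0].

Definition discriminant_variety A : set 'rV[R[i]]_N :=
  [set c : 'rV[R[i]]_N | (forall k, c 0 k != 0) /\
    exists w0 w, singular_point A c w0 w].

(* The Horn-Kapranov parametrization, dehomogenized by omega_0 = 1. *)
Definition horn_kapranov A B (omega : 'rV[R[i]]_n) (t : 'rV[R[i]]_m) :
    'rV[R[i]]_N :=
  \row_(k < N) (expC (1 + alpha_form A k omega) * gale_form B k t).

(* second partial derivatives in w_1, ..., w_n, on the slice w_0 = -1 *)
Definition hessian A (c : 'rV[R[i]]_N) (w : 'rV[R[i]]_n) : 'M[R[i]]_n :=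
  \matrix_(i < n, j < n)
    'D_(delta_mx 0 i)
      (fun v : 'rV[R[i]]_n => 'D_(delta_mx 0 j) (expsum A c (- 1)) v) w.

End Configuration.

Section Submanifold.
Variables (R : realType) (N : nat).
Implicit Types (S U V : set 'rV[R[i]]_N) (phi psi : 'rV[R[i]]_N -> 'rV[R[i]]_N).

Definition holomorphic_on U phi := forall x, U x -> differentiable phi x.

Definition biholomorphic U V phi psi :=
  [/\ holomorphic_on U phi, holomorphic_on V psi,
      (forall x, U x -> V (phi x) /\ psi (phi x) = x)
    & (forall y, V y -> U (psi y) /\ phi (psi y) = y)].

(* Around each of its points, S is carried by a biholomorphic change of
   coordinates to the linear subspace where all coordinates but the first d
   vanish. Such sets are automatically locally closed. *)
Definition complex_submanifold (d : nat) S :=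
  forall p, S p -> exists U V phi psi,
    [/\ open U, open V, U p, biholomorphic U V phi psi
      & forall x, U x ->
          (S x <-> forall k : 'I_N, (d <= k)%N -> phi x 0 k = 0)].

Definition is_hypersurface S :=
  exists M : set 'rV[R[i]]_N,
    [/\ M !=set0, M `<=` S & complex_submanifold N.-1 M].

Definition smooth_point S (p : 'rV[R[i]]_N) :=
  S p /\ exists U, [/\ open U, U p & complex_submanifold N.-1 (S `&` U)].

End Submanifold.

(* Main.v *)
(* With D the diagonal matrix of the <beta_k, t>, the Hessian of Phi(omega; t) at
   -omega is Ahat D Ahat^T, and the Cauchy-Binet formula identifies its
   determinant with P_A(t).

   Let f = Phi(x0) be a smooth point. Near f the discriminant is the zero set of
   a coordinate F of a chart, with dF_f <> 0, and it is the image of Phi because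
   ker A = im B. Hence P_A is not identically zero: otherwise the differential
   of Phi would be singular everywhere, and by Sard's theorem the image of Phi
   could not contain a piece of hypersurface. Where P_A(t) <> 0, the image of
   dPhi is the hyperplane of those c whose exponential sum vanishes at -omega,
   so dF at Phi(omega; t) is proportional to
   e(omega) = (exp (- <omega, alpha_k>))_k; by density this holds for all x near
   x0. If the Hessian at f had a kernel vector w <> 0, there would be a vector v
   over w with dPhi(v) = 0; as dF is Lipschitz, moving along v would not change
   dF to first order, and so would not change the direction of e. Then
   <w, alpha_k> would not depend on k, which contradicts rank A = n + 1.

   Charts are only assumed to be complex differentiable at each point, so that
   the Lipschitz property of dF rests on Goursat's theorem. *)
Require Import Defs.
From mathcomp Require Import all_boot all_order all_algebra fingroup perm.
From mathcomp Require Import all_classical all_reals all_analysis.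
From mathcomp Require Import zify ring lra.
Set Implicit Arguments.
Unset Strict Implicit.
Unset Printing Implicit Defensive.
Import Order.TTheory GRing.Theory Num.Theory.
Import numFieldNormedType.Exports.
Local Open Scope classical_set_scope.
Local Open Scope ring_scope.

(** * Real-valued norms and differentials *)

(** Since N - 1 = n + m, the parametrization and a chart of the hypersurface have the same
    dimension, so that only the equidimensional case of Sard's theorem arises; it is settled by
    counting grid points. The obstacle is regularity. Differentiability at every point does not give
    continuity of dF, which the density argument requires. The last step requires more: along x0 + c
    v the point Phi moves by o(c), and a Lipschitz bound is what turns this into a change of dF by
    o(c). Both follow from a single estimate of the first derivative in one variable, applied along
    complex lines first to F and then to its increments. Constants are crude throughout: most
    factors 2 come from treating real and imaginary parts separately. Norms of [R[i]]-modules take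
    their values in [R[i]]; estimates are carried out in [R], where order and linear arithmetic are
    available. *)

Section RealNorm.
Local Open Scope complex_scope.
Variable R : realType.
Implicit Types (V W : normedModType R[i]).

(* [`|u|] is itself an element of R[i]; [nrm u] is the same norm as a real number. *)
Definition nrm V (u : V) : R := complex.Re `|u|.

Lemma nrmE V (u : V) : `|u| = (nrm u)%:C.
Proof. by rewrite RRe_real // normr_real. Qed.

Lemma nrm_ge0 V (u : V) : 0 <= nrm u.
Proof. by rewrite -lecR -nrmE normr_ge0. Qed.

Lemma nrm0 V : nrm (0 : V) = 0.
Proof. by rewrite /nrm normr0. Qed.

Lemma nrm0_eq0 V (u : V) : nrm u = 0 -> u = 0.
Proof. by move=> h; apply/normr0_eq0; rewrite nrmE h. Qed.

Lemma nrmD V (u v : V) : nrm (u + v) <= nrm u + nrm v.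
Proof. by rewrite -lecR rmorphD /= -!nrmE ler_normD. Qed.

Lemma nrmN V (u : V) : nrm (- u) = nrm u.
Proof. by rewrite /nrm normrN. Qed.

Lemma nrmZ V (a : R[i]) (u : V) : nrm (a *: u) = nrm a * nrm u.
Proof. by apply/complexI; rewrite rmorphM /= -!nrmE normrZ. Qed.

Lemma nrmM (a b : R[i]) : nrm (a * b) = nrm a * nrm b.
Proof. by apply/complexI; rewrite rmorphM /= -!nrmE normrM. Qed.

Lemma nrmV (a : R[i]) : nrm a^-1 = (nrm a)^-1.
Proof. by apply/complexI; rewrite fmorphV /= -!nrmE normfV. Qed.

Lemma nrmX (a : R[i]) k : nrm (a ^+ k) = nrm a ^+ k.
Proof. by apply/complexI; rewrite rmorphXn /= -!nrmE normrX. Qed.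

Lemma nrm_real (x : R) : nrm (x%:C : R[i]) = `|x|.
Proof. by rewrite /nrm normc_def /= expr0n addr0 sqrtr_sqr. Qed.

Lemma nrm_gt0 V (u : V) : u != 0 -> 0 < nrm u.
Proof.
by move=> u0; rewrite lt_def nrm_ge0 andbT; apply: contra_neq u0 => /nrm0_eq0.
Qed.

Lemma nrm_sum V (I : Type) (r : seq I) (P : pred I) (F : I -> V) :
  nrm (\sum_(i <- r | P i) F i) <= \sum_(i <- r | P i) nrm (F i).
Proof.
elim/big_rec2: _ => [|i x y _ h]; first by rewrite nrm0.
by apply: le_trans (nrmD _ _) _; rewrite lerD2l.
Qed.

Lemma ler_Re_nrm (z : R[i]) : `|complex.Re z| <= nrm z.
Proof. by rewrite -lecR -nrmE normc_ge_Re. Qed.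

Lemma ler_Im_nrm (z : R[i]) : `|complex.Im z| <= nrm z.
Proof.
case: z => a b /=; rewrite /nrm normc_def /= -sqrtr_sqr ler_sqrt ?lerDr ?sqr_ge0 //.
by rewrite addr_ge0 ?sqr_ge0.
Qed.

Lemma nrm_le_ReIm (z : R[i]) : nrm z <= `|complex.Re z| + `|complex.Im z|.
Proof.
rewrite {1}(complexE z); apply: le_trans (nrmD _ _) _.
by rewrite nrm_real nrmM nrm_real /nrm normc_def /= expr0n expr1n add0r sqrtr1 mul1r.
Qed.

Lemma nrm_entry n (u : 'rV[R[i]]_n) i : nrm (u 0 i) <= nrm u.
Proof.
rewrite -lecR -!nrmE; rewrite [leRHS]mx_normE.
have := @le_bigmax _ _ _ 0%:nng (fun p : 'I_1 * 'I_n => `|u p.1 p.2|%:nng) (0, i).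
by move=> h; exact: h.
Qed.

Lemma nrm_rV n (u : 'rV[R[i]]_n) (e : R) :
  0 <= e -> (forall i, nrm (u 0 i) <= e) -> nrm u <= e.
Proof.
move=> e0 h; have [->|u0] := eqVneq u 0; first by rewrite nrm0.
have : mx_norm u != 0 by apply: contra_neq u0 => /mx_norm_eq0.
move=> /mx_norm_neq0[[i j]] /= he.
rewrite -lecR -nrmE [leLHS]he (ord1 i) nrmE lecR; exact: h.
Qed.

Lemma entryD n (u v : 'rV[R[i]]_n) j : (u + v) 0 j = u 0 j + v 0 j.
Proof. by rewrite mxE. Qed.

Lemma entryB n (u v : 'rV[R[i]]_n) j : (u - v) 0 j = u 0 j - v 0 j.
Proof. by rewrite !mxE. Qed.

Lemma entryZ n (a : R[i]) (u : 'rV[R[i]]_n) j : (a *: u) 0 j = a * u 0 j.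
Proof. by rewrite mxE. Qed.

Lemma open_nrm V (U : set V) (x : V) : open U -> U x ->
  exists2 d : R, 0 < d & forall y, nrm (y - x) < d -> U y.
Proof.
move=> oU Ux.
have /nbhs_normP [e /= e0 he] : nbhs x U by exact: open_nbhs_nbhs.
(* A positive element of [R[i]] has zero imaginary part, so that it is determined by its real
   part. *)
exists (complex.Re e).
  by move: e0; rewrite ltcE /= => /andP[].
move=> y hy; apply: he; rewrite /ball_ /= distrC nrmE.
by move: e0; rewrite !ltcE /= => /andP[/eqP <- _]; rewrite eqxx.
Qed.

(* [T] is not required to be linear or bounded; this is assumed where it is needed. *)
Definition fdiff V W (f : V -> W) (x : V) (T : V -> W) :=
  forall e : R, 0 < e -> exists2 d : R, 0 < d &
    forall u, nrm u < d -> nrm (f (x + u) - f x - T u) <= e * nrm u.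

Lemma differentiable_fdiff V W (f : V -> W) x :
  differentiable f x -> fdiff f x ('d f x).
Proof.
move=> /diff_locally df e e0.
have /eqaddoP/(_ e%:C) := df; rewrite ltcR => /(_ e0) /nbhs_normP[d /= d0 hd].
exists (complex.Re d); first by move: d0; rewrite ltcE /= => /andP[].
move=> u hu; have : ball_ (fun x => `|x|) 0 d u.
  rewrite /ball_ /= sub0r normrN nrmE.
  by move: d0; rewrite !ltcE /= => /andP[/eqP <- _]; rewrite eqxx.
move=> /hd /=; rewrite !nrmE -rmorphM /= lecR opprD /=.
by rewrite !fctE /= addrA [u + x]addrC.
Qed.

Lemma fdiff_cont V W (f : V -> W) x T (K : R) : fdiff f x T ->
  (forall u, nrm (T u) <= K * nrm u) ->
  forall e : R, 0 < e -> exists2 d : R, 0 < d & forall u, nrm u < d -> nrm (f (x + u) - f x) < e.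
Proof.
move=> fT TK e e0; have [d d0 hd] := fT 1 ltr01.
have K1 : 0 < `|K| + 1 by have := normr_ge0 K; lra.
exists (Num.min d (e / (`|K| + 1))); first by rewrite lt_min d0 divr_gt0.
move=> u; rewrite lt_min ltr_pdivlMr // => /andP[/hd h1 h2].
rewrite -[f (x + u) - f x](subrK (T u)); apply: le_lt_trans (nrmD _ _) _.
have : K * nrm u <= `|K| * nrm u by rewrite ler_wpM2r ?nrm_ge0 ?ler_norm.
by have := TK u; lra.
Qed.

Lemma fdiff_comp V W (X : normedModType R[i]) (f : V -> W) (g : W -> X) x T S (K L : R) :
  fdiff f x T -> fdiff g (f x) S -> (forall u, nrm (T u) <= K * nrm u) ->
  (forall w, nrm (S w) <= L * nrm w) -> {morph S : a b / a - b} ->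
  fdiff (g \o f) x (S \o T).
Proof.
move=> fT gS TK SL SB e e0.
have K0 := normr_ge0 K; have L0 := normr_ge0 L.
have q1 : 0 < e / (2 * (`|K| + 1)) by rewrite divr_gt0 //; lra.
have q2 : 0 < e / (2 * (`|L| + 1)) by rewrite divr_gt0 //; lra.
have [d1 d10 h1] := gS _ q1; have [d2 d20 h2] := fdiff_cont fT TK d10.
have [d3 d30 h3] := fT _ q2; have [d4 d40 h4] := fT 1 ltr01.
exists (Num.min d2 (Num.min d3 d4)); first by rewrite !lt_min d20 d30.
move=> u; rewrite !lt_min => /andP[/h2 l2 /andP[/h3 l3 /h4 l4]] /=.
set w := f (x + u) - f x in l2 l3 l4.
have fw : f (x + u) = f x + w by rewrite /w [RHS]addrC subrK.
have -> : g (f (x + u)) - g (f x) - S (T u) = (g (f x + w) - g (f x) - S w) + S (w - T u).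
  by rewrite SB fw [RHS]addrA subrK.
have U0 := nrm_ge0 u.
have wu : nrm w <= (`|K| + 1) * nrm u.
  rewrite -[w](subrK (T u)); apply: le_trans (nrmD _ _) _.
  have : K * nrm u <= `|K| * nrm u by rewrite ler_wpM2r ?nrm_ge0 ?ler_norm.
  by have := TK u; lra.
have b1 : nrm (g (f x + w) - g (f x) - S w) <= e / 2 * nrm u.
  apply: le_trans (h1 _ l2) _.
  have -> : e / 2 * nrm u = e / (2 * (`|K| + 1)) * ((`|K| + 1) * nrm u) by field; lra.
  by rewrite ler_pM2l.
have b2 : nrm (S (w - T u)) <= e / 2 * nrm u.
  apply: le_trans (SL _) _.
  have -> : e / 2 * nrm u = (`|L| + 1) * (e / (2 * (`|L| + 1)) * nrm u) by field; lra.
  apply: le_trans (ler_wpM2l _ l3); last lra.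
  by rewrite ler_wpM2r ?nrm_ge0 //; have := ler_norm L; lra.
by apply: le_trans (nrmD _ _) _; lra.
Qed.

Lemma fdiffM V (h g : V -> R[i]) x (T S : V -> R[i]) (K L : R) :
  fdiff h x T -> fdiff g x S ->
  (forall u, nrm (T u) <= K * nrm u) -> (forall u, nrm (S u) <= L * nrm u) ->
  fdiff (fun y => h y * g y) x (fun u => T u * g x + h x * S u).
Proof.
move=> hT gS TK SL e e0; have cg := fdiff_cont gS SL.
have A0 := normr_ge0 K; have H0 := nrm_ge0 (h x); have G0 := nrm_ge0 (g x).
have q1 : 0 < e / (3 * (nrm (g x) + 1)) by rewrite divr_gt0 // mulr_gt0 //; lra.
have q2 : 0 < e / (3 * (nrm (h x) + 1)) by rewrite divr_gt0 // mulr_gt0 //; lra.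
have q3 : 0 < e / (3 * (`|K| + 1)) by rewrite divr_gt0 // mulr_gt0 //; lra.
have [d1 d10 k1] := hT _ q1; have [d2 d20 k2] := gS _ q2.
have [d3 d30 k3] := cg _ q3; have [d4 d40 k4] := cg 1 ltr01.
exists (Num.min (Num.min d1 d2) (Num.min d3 d4)); first by rewrite !lt_min d10 d20 d30.
move=> u; rewrite !lt_min => /andP[/andP[/k1 l1 /k2 l2] /andP[/k3 l3 /k4 l4]].
have -> : h (x + u) * g (x + u) - h x * g x - (T u * g x + h x * S u) =
  (h (x + u) - h x - T u) * g (x + u) + h x * (g (x + u) - g x - S u)
   + T u * (g (x + u) - g x) by ring.
have g1 : nrm (g (x + u)) <= nrm (g x) + 1.
  by rewrite -[g (x + u)](subrK (g x)); have := nrmD (g (x + u) - g x) (g x); lra.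
have U0 := nrm_ge0 u.
apply: le_trans (nrmD _ _) _; apply: le_trans (lerD (nrmD _ _) (lexx _)) _.
rewrite !nrmM.
have b1 : nrm (h (x + u) - h x - T u) * nrm (g (x + u)) <= e / 3 * nrm u.
  have -> : e / 3 * nrm u = (e / (3 * (nrm (g x) + 1)) * nrm u) * (nrm (g x) + 1).
    by field; lra.
  by apply: ler_pM; rewrite ?nrm_ge0.
have b2 : nrm (h x) * nrm (g (x + u) - g x - S u) <= e / 3 * nrm u.
  have -> : e / 3 * nrm u = (nrm (h x) + 1) * (e / (3 * (nrm (h x) + 1)) * nrm u).
    by field; lra.
  by apply: ler_pM; rewrite ?nrm_ge0 //; lra.
have b3 : nrm (T u) * nrm (g (x + u) - g x) <= e / 3 * nrm u.
  have -> : e / 3 * nrm u = (`|K| + 1) * nrm u * (e / (3 * (`|K| + 1))).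
    by field; lra.
  apply: ler_pM; rewrite ?nrm_ge0 //; last exact: ltW.
  apply: le_trans (TK u) _; rewrite ler_wpM2r //.
  by have := ler_norm K; lra.
lra.
Qed.

End RealNorm.

(** * Line integrals of complex functions *)

Section Bisection.
Variable R : realType.

Lemma expr2_unbounded (K e : R) : 0 < e -> exists n, K < e * 2 ^+ n.
Proof.
move=> e0; exists (Num.truncn (K / e)).+1.
rewrite mulrC -ltr_pdivrMr //; apply: (lt_trans (truncnS_gt _)).
by rewrite -natrX ltr_nat ltn_expl.
Qed.

Lemma nested_intervals (a b : nat -> R) : (forall n, a n <= a n.+1) ->
  (forall n, b n.+1 <= b n) -> (forall n, a n <= b n) -> exists x, forall n, a n <= x <= b n.
Proof.
have mon (f : nat -> R) : (forall k, f k <= f k.+1) -> forall i j, (i <= j)%N -> f i <= f j.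
  move=> fS i j; elim: j => [|j ih]; first by rewrite leqn0 => /eqP ->.
  by rewrite leq_eqVlt ltnS => /predU1P[-> //|/ih h]; apply: le_trans h (fS j).
move=> /mon ma bS ab.
have mb i j : (i <= j)%N -> b j <= b i.
  by move=> ij; rewrite -lerN2; apply: (mon (fun n => - b n)) ij => k; rewrite lerN2.
have abmn m n : a m <= b n.
  apply: le_trans (ma _ _ (leq_maxl m n)) (le_trans (ab _) (mb _ _ (leq_maxr m n))).
exists (sup (range a)) => n; apply/andP; split.
  by apply: ub_le_sup; [exists (b 0%N) => _ [k _ <-]|exists n].
by apply: ge_sup; [exists (a 0%N), 0%N|move=> _ [k _ <-]].
Qed.

(** If [P] failed, some quarter would be bad, then a quarter of that quarter, and so on. The bad
    rectangles shrink to a point, near which the second hypothesis applies. [P] is abstract so that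
    Goursat's inequality can be plugged in. *)
Lemma rectangle_bisection (P : R -> R -> R -> R -> Prop) (x0 x1 y0 y1 : R) :
  x0 <= x1 -> y0 <= y1 ->
  (forall a b c d, x0 <= a -> a <= b -> b <= x1 -> y0 <= c -> c <= d -> d <= y1 ->
     P a ((a + b) / 2) c ((c + d) / 2) -> P ((a + b) / 2) b c ((c + d) / 2) ->
     P a ((a + b) / 2) ((c + d) / 2) d -> P ((a + b) / 2) b ((c + d) / 2) d ->
     P a b c d) ->
  (forall x y, x0 <= x <= x1 -> y0 <= y <= y1 -> exists2 e : R, 0 < e &
     forall a b c d, x0 <= a <= x -> x <= b <= x1 -> y0 <= c <= y -> y <= d <= y1 ->
       b - a < e -> d - c < e -> P a b c d) ->
  P x0 x1 y0 y1.
Proof.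
move=> hx hy split loc; apply: contrapT => nP.
pose Q (r : R * R * R * R) := let: (a, b, c, d) := r in
  [/\ x0 <= a, a <= b & b <= x1] /\ [/\ y0 <= c, c <= d & d <= y1] /\ ~ P a b c d.
pose S (r s : R * R * R * R) := let: (a, b, c, d) := r in let: (a', b', c', d') := s in
  [/\ a <= a', b' <= b, b' - a' = (b - a) / 2 &
   [/\ c <= c', d' <= d & d' - c' = (d - c) / 2]].
(* The implication under the quantifier makes the choice of a bad quarter total, as [choice]
   requires. *)
have step r : exists s, Q r -> Q s /\ S r s.
  case: r => [[[a b] c] d].
  have [Qr|] := pselect (Q (a, b, c, d)); last by move=> nQ; exists (a, b, c, d).
  have [[h1 h2 h3] [[h4 h5 h6] nPr]] := Qr.
  set m := (a + b) / 2; set n := (c + d) / 2.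
  have ma : m * 2 = a + b by rewrite /m divfK.
  have nc : n * 2 = c + d by rewrite /n divfK.
  have [p1|n1] := pselect (P a m c n); last first.
    by exists (a, m, c, n) => _; split; rewrite /Q /S //; repeat split => //; lra.
  have [p2|n2] := pselect (P m b c n); last first.
    by exists (m, b, c, n) => _; split; rewrite /Q /S //; repeat split => //; lra.
  have [p3|n3] := pselect (P a m n d); last first.
    by exists (a, m, n, d) => _; split; rewrite /Q /S //; repeat split => //; lra.
  have [p4|n4] := pselect (P m b n d); last first.
    by exists (m, b, n, d) => _; split; rewrite /Q /S //; repeat split => //; lra.
  by case: nPr; apply: split.
have [F HF] := choice step.
pose r n := iter n F (x0, x1, y0, y1).
pose A n := (r n).1.1.1; pose B n := (r n).1.1.2.
pose C n := (r n).1.2; pose D n := (r n).2.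
have rE n : r n = (A n, B n, C n, D n).
  by rewrite /A /B /C /D; case: (r n) => [[[? ?] ?] ?].
have Qr n : Q (r n).
  elim: n => [|n ih]; first by rewrite /r /Q /=.
  by have [] := HF _ ih.
have Sr n : S (r n) (r n.+1) by have [] := HF _ (Qr n).
have Qn n : [/\ x0 <= A n, A n <= B n & B n <= x1] /\
  [/\ y0 <= C n, C n <= D n & D n <= y1] /\ ~ P (A n) (B n) (C n) (D n).
  by have := Qr n; rewrite rE.
have Sn n : [/\ A n <= A n.+1, B n.+1 <= B n, B n.+1 - A n.+1 = (B n - A n) / 2 &
   [/\ C n <= C n.+1, D n.+1 <= D n & D n.+1 - C n.+1 = (D n - C n) / 2]].
  by have := Sr n; rewrite !rE.
have wid n : (B n - A n) * 2 ^+ n = x1 - x0 /\ (D n - C n) * 2 ^+ n = y1 - y0.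
  elim: n => [|n [ih1 ih2]]; first by rewrite !mulr1.
  have [_ _ -> [_ _ ->]] := Sn n; by rewrite exprS -ih1 -ih2 !mulrA !divfK.
have [x hxn] : exists x, forall n, A n <= x <= B n.
  by apply: nested_intervals => n; [have [] := Sn n|have [] := Sn n|have [[]] := Qn n].
have [y hyn] : exists y, forall n, C n <= y <= D n.
  by apply: nested_intervals => n; [have [? ? ? []] := Sn n|have [? ? ? []] := Sn n|have [_ [[]]] := Qn n].
have [||e e0 he] := loc x y.
- by have := hxn 0%N; have [[? ? ?] _] := Qn 0%N; move=> /andP[? ?]; apply/andP; split; lra.
- by have := hyn 0%N; have [_ [[? ? ?] _]] := Qn 0%N; move=> /andP[? ?]; apply/andP; split; lra.
have [n hn] := expr2_unbounded (x1 - x0 + (y1 - y0)) e0.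
have [[? ? ?] [[? ? ?] nPn]] := Qn n; have [w1 w2] := wid n.
have p2 : 0 < (2 : R) ^+ n by rewrite exprn_gt0.
have /andP[? ?] := hxn n; have /andP[? ?] := hyn n.
apply: nPn; apply: he; try (by apply/andP; split).
- by rewrite -(ltr_pM2r p2) w1; lra.
- by rewrite -(ltr_pM2r p2) w2; lra.
Qed.

End Bisection.

Section ComplexIntegral.
Local Open Scope complex_scope.
Variable R : realType.
Local Notation C := R[i].
Local Notation mu := (@lebesgue_measure R).

Definition rcont (f : R -> R) (a b : R) :=
  forall x, a <= x <= b -> {for x, continuous f}.

Lemma rcont_integrable f a b : rcont f a b -> mu.-integrable `[a, b] (EFin \o f).
Proof.
move=> cf; apply: continuous_compact_integrable; first exact: segment_compact.
apply: continuous_in_subspaceT => x; rewrite inE /= in_itv /=; exact: cf.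
Qed.

Definition rint (f : R -> R) a b : R := \int[mu]_(x in `[a, b]) f x.

Lemma rintD f g a b : rcont f a b -> rcont g a b ->
  rint (fun x => f x + g x) a b = rint f a b + rint g a b.
Proof. by move=> cf cg; rewrite /rint RintegralD //; exact: rcont_integrable. Qed.

Lemma rintZ r f a b : rcont f a b -> rint (fun x => r * f x) a b = r * rint f a b.
Proof. by move=> cf; rewrite /rint RintegralZl //; exact: rcont_integrable. Qed.

Lemma rint_cst r a b : a <= b -> rint (fun=> r) a b = r * (b - a).
Proof.
move=> ab; rewrite /rint Rintegral_cst //= lebesgue_measure_itv /= lte_fin.
have [//|] := ltP a b.
by move=> ba; have -> : a = b by [apply/le_anti; rewrite ab ba]; rewrite subrr.
Qed.

Lemma rint_le f g a b : rcont f a b -> rcont g a b ->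
  (forall x, a <= x <= b -> f x <= g x) -> rint f a b <= rint g a b.
Proof.
move=> cf cg fg; apply: le_Rintegral => //; try exact: rcont_integrable.
Qed.

Lemma rint_chasles f a b c : a <= b -> b <= c -> rcont f a c ->
  rint f a c = rint f a b + rint f b c.
Proof.
move=> ab bc cf; have ac := rcont_integrable cf.
have cbc : rcont f b c by move=> x /andP[? ?]; apply: cf; apply/andP; split; lra.
have := @Rintegral_itvB _ f (BLeft a) (BRight c) b ac.
rewrite !bnd_simp => /(_ ab bc) /eqP; rewrite subr_eq => /eqP h; rewrite /rint h addrC; congr (_ + _).
rewrite -Rintegral_itv_obnd_cbnd //; apply: integrableS (rcont_integrable cbc) => //.
by apply: subset_itvr; rewrite bnd_simp.
Qed.

Lemma eq_rint f g a b : (forall x, a <= x <= b -> f x = g x) -> rint f a b = rint g a b.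
Proof. by move=> fg; apply: eq_Rintegral => x; rewrite inE /= in_itv /=; exact: fg. Qed.

(** The condition is two-sided even at the end points; the integrands below are continuous in a
    neighbourhood of the contour's points. *)
Definition scont (g : R -> C) (a b : R) :=
  forall x, a <= x <= b -> forall e : R, 0 < e -> exists2 d, 0 < d &
    forall y, `|y - x| < d -> nrm (g y - g x) < e.

Definition cint (g : R -> C) a b : C :=
  rint (fun x => complex.Re (g x)) a b +i* rint (fun x => complex.Im (g x)) a b.

Lemma scont_Re g a b : scont g a b -> rcont (fun x => complex.Re (g x)) a b.
Proof.
move=> cg x hx; apply/cvgrPdist_lt => e e0.
have [d d0 hd] := cg x hx e e0.
near=> y; apply: le_lt_trans (hd y _).
  by rewrite distrC -raddfB; exact: ler_Re_nrm.
near: y; apply/nbhs_normP; exists d => //= y; by rewrite /ball_ /= distrC.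
Unshelve. all: by end_near. Qed.

Lemma scont_Im g a b : scont g a b -> rcont (fun x => complex.Im (g x)) a b.
Proof.
move=> cg x hx; apply/cvgrPdist_lt => e e0.
have [d d0 hd] := cg x hx e e0.
near=> y; apply: le_lt_trans (hd y _).
  by rewrite distrC -raddfB; exact: ler_Im_nrm.
near: y; apply/nbhs_normP; exists d => //= y; by rewrite /ball_ /= distrC.
Unshelve. all: by end_near. Qed.

Lemma scontD g h a b : scont g a b -> scont h a b -> scont (fun x => g x + h x) a b.
Proof.
move=> cg ch x hx e e0; have e2 : 0 < e / 2 by lra.
have [d1 d10 h1] := cg x hx _ e2; have [d2 d20 h2] := ch x hx _ e2.
exists (Num.min d1 d2); first by rewrite lt_min d10 d20.
move=> y; rewrite lt_min => /andP[/h1 k1 /h2 k2].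
by rewrite opprD addrACA; apply: le_lt_trans (nrmD _ _) _; lra.
Qed.

Lemma scontZ c g a b : scont g a b -> scont (fun x => c * g x) a b.
Proof.
move=> cg x hx e e0.
have c1 : 0 < nrm c + 1 by have := nrm_ge0 c; lra.
have [d d0 h] := cg x hx _ (divr_gt0 e0 c1).
exists d => // y /h; rewrite ltr_pdivlMr // => k.
rewrite -mulrBr nrmM; apply: le_lt_trans k; rewrite mulrC.
by rewrite ler_wpM2l ?nrm_ge0 //; lra.
Qed.

Lemma scont_sub g a b a' b' : a <= a' -> b' <= b -> scont g a b -> scont g a' b'.
Proof. by move=> ? ? cg x /andP[? ?]; apply: cg; apply/andP; split; lra. Qed.

Lemma eq_cint g h a b : (forall x, a <= x <= b -> g x = h x) -> cint g a b = cint h a b.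
Proof. by move=> gh; rewrite /cint; congr (_ +i* _); apply: eq_rint => x /gh ->. Qed.

Lemma rcontZ r f a b : rcont f a b -> rcont (fun x => r * f x) a b.
Proof. by move=> cf x hx; apply: cvgM; [exact: cvg_cst|exact: cf]. Qed.

Lemma cintD g h a b : scont g a b -> scont h a b ->
  cint (fun x => g x + h x) a b = cint g a b + cint h a b.
Proof.
move=> cg ch; rewrite /cint [RHS]/GRing.add /=.
have -> : (fun x => complex.Re (g x + h x)) = (fun x => complex.Re (g x) + complex.Re (h x)).
  by apply/funext => x; rewrite raddfD.
have -> : (fun x => complex.Im (g x + h x)) = (fun x => complex.Im (g x) + complex.Im (h x)).
  by apply/funext => x; rewrite raddfD.
by rewrite !rintD //; try exact: scont_Re; exact: scont_Im.
Qed.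

Lemma cintZ c g a b : scont g a b -> cint (fun x => c * g x) a b = c * cint g a b.
Proof.
move=> cg; rewrite /cint; case: c => u v; have cr := scont_Re cg; have ci := scont_Im cg.
have -> : (fun x => complex.Re ((u +i* v) * g x)) =
  (fun x => u * complex.Re (g x) + (- v) * complex.Im (g x)).
  by apply/funext => x; case: (g x) => p q /=; rewrite mulNr.
have -> : (fun x => complex.Im ((u +i* v) * g x)) =
  (fun x => u * complex.Im (g x) + v * complex.Re (g x)).
  by apply/funext => x; case: (g x) => p q.
rewrite !rintD ?rintZ //; try exact: rcontZ.
by rewrite [RHS]/GRing.mul /= mulNr.
Qed.

Lemma cintB g h a b : scont g a b -> scont h a b ->
  cint (fun x => g x - h x) a b = cint g a b - cint h a b.
Proof.
move=> cg ch; rewrite -[- cint h a b]mulN1r -cintZ // -cintD //; last exact: scontZ.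
by apply: eq_cint => x _; rewrite mulN1r.
Qed.

Lemma cint_cst c a b : a <= b -> cint (fun=> c) a b = c * (b - a)%:C.
Proof.
by move=> ab; rewrite /cint !rint_cst //; case: c => u v; rewrite [RHS]/GRing.mul /= !mulr0 subr0 add0r.
Qed.

Lemma cint_chasles g a b c : a <= b -> b <= c -> scont g a c ->
  cint g a c = cint g a b + cint g b c.
Proof.
move=> ab bc cg; rewrite /cint (rint_chasles ab bc) ?(rint_chasles (f := fun x => complex.Im _) ab bc) //.
  exact: scont_Im.
exact: scont_Re.
Qed.

Lemma rint_bound f a b M : a <= b -> rcont f a b ->
  (forall x, a <= x <= b -> `|f x| <= M) -> `|rint f a b| <= M * (b - a).
Proof.
move=> ab cf fM; rewrite ler_norml; apply/andP; split.
  rewrite -mulNr -rint_cst //; apply: rint_le => //.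
    by move=> x _; exact: cvg_cst.
  by move=> x /fM; rewrite ler_norml => /andP[].
rewrite -rint_cst //; apply: rint_le => //.
  by move=> x _; exact: cvg_cst.
by move=> x /fM; rewrite ler_norml => /andP[].
Qed.

(** The two real integrals are bounded separately, hence the factor 2. *)
Lemma cint_bound g a b M : a <= b -> scont g a b ->
  (forall x, a <= x <= b -> nrm (g x) <= M) -> nrm (cint g a b) <= 2 * M * (b - a).
Proof.
move=> ab cg gM; apply: le_trans (nrm_le_ReIm _) _ => /=.
have h1 := @rint_bound _ a b M ab (scont_Re cg).
have h2 := @rint_bound _ a b M ab (scont_Im cg).
suff : `|rint (fun x => complex.Re (g x)) a b| <= M * (b - a) /\
       `|rint (fun x => complex.Im (g x)) a b| <= M * (b - a) by move=> []; lra.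
split; [apply: h1|apply: h2] => x /gM; apply: le_trans.
  exact: ler_Re_nrm.
exact: ler_Im_nrm.
Qed.

End ComplexIntegral.

(** * Goursat's theorem and Cauchy's estimate *)

Section Goursat.
Local Open Scope complex_scope.
Variable R : realType.
Local Notation C := R[i].
Implicit Types h g : C -> C.

Definition ccont h (z : C) := forall e : R, 0 < e -> exists2 d : R, 0 < d &
  forall u, nrm u < d -> nrm (h (z + u) - h z) < e.

Definition cdiff h (z d : C) := fdiff h z (fun u => d * u).

Lemma cdiff_cont h z d : cdiff h z d -> ccont h z.
Proof.
by move=> hd; apply: (fdiff_cont (K := nrm d) hd) => u; rewrite nrmM.
Qed.

Definition on_rect x0 x1 y0 y1 (P : C -> Prop) : Prop :=
  forall x y, x0 <= x <= x1 -> y0 <= y <= y1 -> P (x +i* y).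

Definition hint h y a b : C := cint (fun x => h (x +i* y)) a b.
Definition vint h x a b : C := cint (fun y => h (x +i* y)) a b.

(** The integral of h(z) dz along the boundary, counterclockwise: dz is dx on horizontal edges and i
    dy on vertical ones. *)
Definition rectint h x0 x1 y0 y1 : C :=
  hint h y0 x0 x1 - hint h y1 x0 x1 + 'i * (vint h x1 y0 y1 - vint h x0 y0 y1).

Lemma scont_hor h x0 x1 y : (forall x, x0 <= x <= x1 -> ccont h (x +i* y)) ->
  scont (fun x => h (x +i* y)) x0 x1.
Proof.
move=> hc x hx e e0; have [d d0 hd] := hc x hx e e0; exists d => // x' hx'.
have -> : x' +i* y = x +i* y + (x' - x)%:C by rewrite [RHS]/GRing.add /=; congr (_ +i* _); ring.
by apply: hd; rewrite nrm_real.
Qed.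

Lemma scont_ver h x y0 y1 : (forall y, y0 <= y <= y1 -> ccont h (x +i* y)) ->
  scont (fun y => h (x +i* y)) y0 y1.
Proof.
move=> hc y hy e e0; have [d d0 hd] := hc y hy e e0; exists d => // y' hy'.
have -> : x +i* y' = x +i* y + (0 +i* (y' - y)) by rewrite [RHS]/GRing.add /=; congr (_ +i* _); ring.
by apply: hd; apply: le_lt_trans (nrm_le_ReIm _) _; rewrite /= normr0 add0r.
Qed.

(** Continuity is asked on the four edges alone, so that integrands with a pole inside, such as 1 /
    z, are covered. *)
Definition edge_cont h x0 x1 y0 y1 :=
  [/\ scont (fun x => h (x +i* y0)) x0 x1, scont (fun x => h (x +i* y1)) x0 x1,
      scont (fun y => h (x0 +i* y)) y0 y1 & scont (fun y => h (x1 +i* y)) y0 y1].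

Lemma rect_edge_cont h x0 x1 y0 y1 : x0 <= x1 -> y0 <= y1 ->
  on_rect x0 x1 y0 y1 (ccont h) -> edge_cont h x0 x1 y0 y1.
Proof.
move=> hx hy hc; split.
- by apply: scont_hor => x k; apply: hc; rewrite ?lexx ?hx ?hy.
- by apply: scont_hor => x k; apply: hc; rewrite ?lexx ?hx ?hy.
- by apply: scont_ver => x k; apply: hc; rewrite ?lexx ?hx ?hy.
- by apply: scont_ver => x k; apply: hc; rewrite ?lexx ?hx ?hy.
Qed.

Lemma rectintD h g x0 x1 y0 y1 : edge_cont h x0 x1 y0 y1 -> edge_cont g x0 x1 y0 y1 ->
  rectint (fun z => h z + g z) x0 x1 y0 y1 = rectint h x0 x1 y0 y1 + rectint g x0 x1 y0 y1.
Proof. by move=> [? ? ? ?] [? ? ? ?]; rewrite /rectint /hint /vint !cintD //; ring. Qed.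

Lemma rectintZ c h x0 x1 y0 y1 : edge_cont h x0 x1 y0 y1 ->
  rectint (fun z => c * h z) x0 x1 y0 y1 = c * rectint h x0 x1 y0 y1.
Proof. by move=> [? ? ? ?]; rewrite /rectint /hint /vint !cintZ //; ring. Qed.

Lemma rectint_bound h x0 x1 y0 y1 M : x0 <= x1 -> y0 <= y1 -> edge_cont h x0 x1 y0 y1 ->
  (forall x, x0 <= x <= x1 -> nrm (h (x +i* y0)) <= M /\ nrm (h (x +i* y1)) <= M) ->
  (forall y, y0 <= y <= y1 -> nrm (h (x0 +i* y)) <= M /\ nrm (h (x1 +i* y)) <= M) ->
  nrm (rectint h x0 x1 y0 y1) <= 4 * M * (x1 - x0 + (y1 - y0)).
Proof.
move=> hx hy [c1 c2 c3 c4] H V; rewrite /rectint.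
have b1 : nrm (hint h y0 x0 x1) <= 2 * M * (x1 - x0) by apply: cint_bound => // x /H[].
have b2 : nrm (hint h y1 x0 x1) <= 2 * M * (x1 - x0) by apply: cint_bound => // x /H[].
have b3 : nrm (vint h x0 y0 y1) <= 2 * M * (y1 - y0) by apply: cint_bound => // x /V[].
have b4 : nrm (vint h x1 y0 y1) <= 2 * M * (y1 - y0) by apply: cint_bound => // x /V[].
have i1 : nrm ('i : C) = 1 by rewrite /nrm normc_def /= expr0n expr1n add0r sqrtr1.
apply: le_trans (nrmD _ _) _; rewrite nrmM i1 mul1r.
have := nrmD (hint h y0 x0 x1) (- hint h y1 x0 x1).
have := nrmD (vint h x1 y0 y1) (- vint h x0 y0 y1).
rewrite !nrmN; lra.
Qed.

Lemma rectint_splitx h x0 m x1 y0 y1 : x0 <= m -> m <= x1 -> y0 <= y1 ->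
  on_rect x0 x1 y0 y1 (ccont h) ->
  rectint h x0 x1 y0 y1 = rectint h x0 m y0 y1 + rectint h m x1 y0 y1.
Proof.
move=> h1 h2 hy hc; have [c1 c2 c3 c4] := rect_edge_cont (le_trans h1 h2) hy hc.
by rewrite /rectint /hint (cint_chasles h1 h2 c1) (cint_chasles h1 h2 c2); ring.
Qed.

Lemma rectint_splity h x0 x1 y0 n y1 : x0 <= x1 -> y0 <= n -> n <= y1 ->
  on_rect x0 x1 y0 y1 (ccont h) ->
  rectint h x0 x1 y0 y1 = rectint h x0 x1 y0 n + rectint h x0 x1 n y1.
Proof.
move=> hx h1 h2 hc; have [c1 c2 c3 c4] := rect_edge_cont hx (le_trans h1 h2) hc.
by rewrite /rectint /vint (cint_chasles h1 h2 c3) (cint_chasles h1 h2 c4); ring.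
Qed.

Lemma affine_cont (a b z : C) : ccont (fun w => a + b * w) z.
Proof.
apply: (@cdiff_cont _ _ b) => e e0; exists 1 => // u _.
have -> : a + b * (z + u) - (a + b * z) - b * u = 0 by ring.
by rewrite nrm0 mulr_ge0 ?nrm_ge0 // ltW.
Qed.

(** Values on opposite edges differ by the constant [b] times the displacement; the two pairs of
    edges thus contribute opposite multiples of the area. *)
Lemma rectint_affine (a b : C) x0 x1 y0 y1 : x0 <= x1 -> y0 <= y1 ->
  rectint (fun z => a + b * z) x0 x1 y0 y1 = 0.
Proof.
move=> hx hy.
have [c1 c2 c3 c4] : edge_cont (fun z => a + b * z) x0 x1 y0 y1.
  by apply: rect_edge_cont => // x y _ _; exact: affine_cont.
rewrite /rectint /hint /vint -!cintB //.
have -> : (fun x : R => a + b * (x +i* y0) - (a + b * (x +i* y1))) =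
  fun=> b * (0 +i* (y0 - y1)).
  apply/funext => x; have -> : 0 +i* (y0 - y1) = x +i* y0 - (x +i* y1).
    by rewrite [RHS]/GRing.add /= subrr.
  by rewrite mulrBr opprD addrACA subrr add0r.
have -> : (fun y : R => a + b * (x1 +i* y) - (a + b * (x0 +i* y))) =
  fun=> b * (x1 - x0)%:C.
  apply/funext => y; have -> : (x1 - x0)%:C = x1 +i* y - (x0 +i* y).
    by rewrite [RHS]/GRing.add /= subrr.
  by rewrite mulrBr opprD addrACA subrr add0r.
rewrite !cint_cst //; have -> : 0 +i* (y0 - y1) = - ('i * (y1 - y0)%:C).
  by apply/eqP; rewrite eq_complex /=; apply/andP; split; apply/eqP; ring.
by ring.
Qed.

(** For each e > 0 the integral is at most e times the square of width plus height. This bound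
    passes from the quarters to the rectangle because 4 (1/2)^2 = 1, and it holds on small
    rectangles because subtracting the affine approximation of [h] does not change the integral. *)
Theorem goursat h x0 x1 y0 y1 : x0 <= x1 -> y0 <= y1 ->
  on_rect x0 x1 y0 y1 (fun z => exists d, cdiff h z d) ->
  rectint h x0 x1 y0 y1 = 0.
Proof.
move=> hx hy hd.
have hc : on_rect x0 x1 y0 y1 (ccont h).
  by move=> x y kx ky; have [d /cdiff_cont] := hd x y kx ky.
have hcs a b c d : x0 <= a -> b <= x1 -> y0 <= c -> d <= y1 -> on_rect a b c d (ccont h).
  by move=> ? ? ? ? x y /andP[? ?] /andP[? ?]; apply: hc; apply/andP; split; lra.
suff key e : 0 < e -> nrm (rectint h x0 x1 y0 y1) <= e * (x1 - x0 + (y1 - y0)) ^+ 2.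
  apply: nrm0_eq0; apply/le_anti; rewrite nrm_ge0 andbT.
  apply/ler_addgt0Pr => e e0; rewrite add0r.
  set S := (x1 - x0 + (y1 - y0)) ^+ 2.
  have S0 : 0 <= S by rewrite sqr_ge0.
  have S1 : 0 < S + 1 by lra.
  apply: le_trans (key _ (divr_gt0 e0 S1)) _.
  by rewrite mulrAC ler_pdivrMr // ler_pM2l // lerDl ler01.
move=> e0.
apply: (@rectangle_bisection _ (fun a b c d =>
  nrm (rectint h a b c d) <= e * (b - a + (d - c)) ^+ 2)) => //.
  move=> a b c d h1 h2 h3 h4 h5 h6; set m := (a + b) / 2; set n := (c + d) / 2.
  have ma : m * 2 = a + b by rewrite /m divfK.
  have nc : n * 2 = c + d by rewrite /n divfK.
  have [am mb cn nd] : [/\ a <= m, m <= b, c <= n & n <= d] by split; lra.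
  have -> : rectint h a b c d = rectint h a m c n + rectint h m b c n +
     (rectint h a m n d + rectint h m b n d).
    rewrite (rectint_splity h2 cn nd); last exact: hcs.
    by rewrite !(rectint_splitx am mb) //; apply: hcs => //; lra.
  have -> : m - a = (b - a) / 2 by rewrite /m; field.
  have -> : b - m = (b - a) / 2 by rewrite /m; field.
  have -> : n - c = (d - c) / 2 by rewrite /n; field.
  have -> : d - n = (d - c) / 2 by rewrite /n; field.
  have -> : (b - a) / 2 + (d - c) / 2 = (b - a + (d - c)) / 2 by ring.
  set S := b - a + (d - c).
  have -> : (S / 2) ^+ 2 = S ^+ 2 / 4 by field.
  move=> k1 k2 k3 k4; apply: le_trans (nrmD _ _) _.
  apply: le_trans (lerD (nrmD _ _) (nrmD _ _)) _; lra.
move=> x y kx ky; have [d dd] := hd x y kx ky.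
(* The 4 offsets the constant of [rectint_bound]. *)
have e4 : 0 < e / 4 by lra.
have [r r0 hr] := dd _ e4; exists (r / 2); first lra.
move=> a b c d' /andP[a1 a2] /andP[b1 b2] /andP[c1 c2] /andP[d1 d2] w1 w2.
have [ab cd] : a <= b /\ c <= d' by split; lra.
set z := x +i* y.
pose g w := h w + (- (h z - d * z) + (- d) * w).
have -> : rectint h a b c d' = rectint g a b c d'.
  have ch : on_rect a b c d' (ccont h) by apply: hcs; lra.
  rewrite rectintD ?rectint_affine ?addr0 //; first exact: rect_edge_cont.
  by apply: rect_edge_cont => // s t _ _; exact: affine_cont.
have cg : edge_cont g a b c d'.
  have [p1 p2 p3 p4] : edge_cont h a b c d' by apply: rect_edge_cont => //; apply: hcs; lra.
  have [q1 q2 q3 q4] : edge_cont (fun w => - (h z - d * z) + - d * w) a b c d'.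
    by apply: rect_edge_cont => // s t _ _; exact: affine_cont.
  by split; apply: scontD.
have gb s t : a <= s <= b -> c <= t <= d' -> nrm (g (s +i* t)) <= e / 4 * (b - a + (d' - c)).
  move=> /andP[s1 s2] /andP[t1 t2].
  have -> : g (s +i* t) = h (z + ((s - x) +i* (t - y))) - h z - d * ((s - x) +i* (t - y)).
    rewrite /g; have -> : (s - x) +i* (t - y) = s +i* t - z by rewrite [RHS]/GRing.add.
    have -> : z + (s +i* t - z) = s +i* t by rewrite addrC subrK.
    by move: (s +i* t) => w; ring.
  have ub : nrm ((s - x) +i* (t - y)) <= b - a + (d' - c).
    apply: le_trans (nrm_le_ReIm _) _ => /=; apply: lerD; rewrite ler_norml; apply/andP; split; lra.
  apply: le_trans (hr _ _) _; first by apply: le_lt_trans ub _; lra.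
  by rewrite ler_pM2l.
have kb : nrm (rectint g a b c d') <= 4 * (e / 4 * (b - a + (d' - c))) * (b - a + (d' - c)).
  apply: rectint_bound => // [s k|t k]; split; apply: gb => //; by rewrite ?lexx ?ab ?cd.
apply: le_trans kb _; rewrite le_eqVlt; apply/orP; left; apply/eqP; by field.
Qed.

End Goursat.

Section CauchyEstimate.
Local Open Scope complex_scope.
Variable R : realType.
Local Notation C := R[i].
Implicit Types h g : C -> C.

Lemma cdiffM h g z a b : cdiff h z a -> cdiff g z b ->
  cdiff (fun w => h w * g w) z (a * g z + h z * b).
Proof.
move=> ha gb.
have /= := fdiffM (K := nrm a) (L := nrm b) ha gb.
have -> : (fun u => a * u * g z + h z * (b * u)) = (fun u => (a * g z + h z * b) * u).
  by apply/funext => u; ring.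
by apply => u; rewrite nrmM.
Qed.

Lemma cdiffV (z : C) : z != 0 -> cdiff (fun w => w^-1) z (- (z^-1 * z^-1)).
Proof.
move=> z0 e e0; have Z0 := nrm_gt0 z0.
(* The remainder is u^2 / (z^2 (z + u)), and |z + u| is at least |z| / 2 once |u| is at most |z| /
   2. *)
have q : 0 < e * nrm z ^+ 3 / 2 by rewrite divr_gt0 // mulr_gt0 // exprn_gt0.
exists (Num.min (nrm z / 2) (e * nrm z ^+ 3 / 2)); first by rewrite lt_min q andbT; lra.
move=> u; rewrite lt_min => /andP[u1 u2].
have zu : nrm z / 2 <= nrm (z + u).
  by have := nrmD (z + u) (- u); rewrite addrK nrmN; lra.
have zu0 : z + u != 0 by apply: contraTneq zu => ->; rewrite nrm0 -ltNge; lra.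
have -> : (z + u)^-1 - z^-1 - - (z^-1 * z^-1) * u = u * (u / (z ^+ 2 * (z + u))).
  by field; rewrite z0 zu0.
rewrite nrmM mulrC ler_wpM2r ?nrm_ge0 // nrmM nrmV nrmM nrmX.
have p0 : 0 < nrm z ^+ 2 by rewrite exprn_gt0.
rewrite ler_pdivrMr; last by rewrite mulr_gt0 //; lra.
apply: le_trans (ltW u2) _; rewrite -mulrA ler_wpM2l ?(ltW e0) //.
by rewrite exprSr -mulrA ler_wpM2l // ltW.
Qed.

(** Bookkeeping for two concentric squares. [b], [t], [l], [g] stand for the bottom, top, left and
    right edges of the outer one, [m], [n] for bottom and top of the inner one, and [p], [q] for the
    vertical lines through its left and right edges; indices number the pieces. *)
Lemma annulus_edges (K : comPzRingType) (i b1 b2 b3 t1 t2 t3 l g p1 p2 p3 q1 q2 q3 m n : K) :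
  b1 - t1 + i * (p1 + p2 + p3 - l) = 0 -> b3 - t3 + i * (g - (q1 + q2 + q3)) = 0 ->
  b2 - m + i * (q1 - p1) = 0 -> n - t2 + i * (q3 - p3) = 0 ->
  b1 + b2 + b3 - (t1 + t2 + t3) + i * (g - l) = m - n + i * (q2 - p2).
Proof.
move=> z1 z2 z3 z4; apply/eqP; rewrite -subr_eq0; apply/eqP.
have -> : b1 + b2 + b3 - (t1 + t2 + t3) + i * (g - l) - (m - n + i * (q2 - p2)) =
  (b1 - t1 + i * (p1 + p2 + p3 - l)) + (b3 - t3 + i * (g - (q1 + q2 + q3))) +
  (b2 - m + i * (q1 - p1)) + (n - t2 + i * (q3 - p3)) by ring.
by rewrite z1 z2 z3 z4 !addr0.
Qed.

(** The region between the squares is cut into two strips of full height and two short rectangles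
    below and above the inner square; all four avoid 0, and Goursat's theorem applies to each. *)
Lemma annulus_rectint h (s r : R) : 0 < r -> r <= s ->
  (forall x y, - s <= x <= s -> - s <= y <= s -> x +i* y != 0 -> exists d, cdiff h (x +i* y) d) ->
  rectint h (- s) s (- s) s = rectint h (- r) r (- r) r.
Proof.
move=> r0 rs hd.
have ne x y : (r <= `|x|) || (r <= `|y|) -> x +i* y != 0.
  by apply: contraTneq => -[-> ->]; rewrite normr0; lra.
have hd' x y : - s <= x <= s -> - s <= y <= s -> (r <= `|x|) || (r <= `|y|) ->
    exists d, cdiff h (x +i* y) d.
  by move=> ? ? /ne; exact: hd.
have absl x : x <= - r -> r <= `|x| by move=> ?; rewrite ler0_norm; lra.
have absr x : r <= x -> r <= `|x| by move=> ?; rewrite ger0_norm; lra.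
have z1 : rectint h (- s) (- r) (- s) s = 0.
  apply: goursat; [lra|lra|move=> x y /andP[? ?] ky].
  by apply: hd' => //; [apply/andP; split; lra|rewrite absl].
have z2 : rectint h r s (- s) s = 0.
  apply: goursat; [lra|lra|move=> x y /andP[? ?] ky].
  by apply: hd' => //; [apply/andP; split; lra|rewrite absr].
have z3 : rectint h (- r) r (- s) (- r) = 0.
  apply: goursat; [lra|lra|move=> x y /andP[? ?] /andP[? ?]].
  by apply: hd'; [apply/andP; split; lra|apply/andP; split; lra|rewrite [X in _ || X]absl ?orbT].
have z4 : rectint h (- r) r r s = 0.
  apply: goursat; [lra|lra|move=> x y /andP[? ?] /andP[? ?]].
  by apply: hd'; [apply/andP; split; lra|apply/andP; split; lra|rewrite [X in _ || X]absr ?orbT].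
have ch x y : - s <= x <= s -> - s <= y <= s -> (r <= `|x|) || (r <= `|y|) -> ccont h (x +i* y).
  by move=> a b c; have [d /cdiff_cont] := hd' _ _ a b c.
have ss : - s <= - s <= s by apply/andP; split; lra.
have ss' : - s <= s <= s by apply/andP; split; lra.
have rr : - s <= - r <= s by apply/andP; split; lra.
have rr' : - s <= r <= s by apply/andP; split; lra.
have a1 : r <= `|- s| by rewrite absl //; lra.
have a2 : r <= `|s| by rewrite absr //; lra.
have a3 : r <= `|- r| by rewrite absl //; lra.
have a4 : r <= `|r| by rewrite absr //; lra.
have chasles3 (g : R -> C) : scont g (- s) s ->
    cint g (- s) s = cint g (- s) (- r) + cint g (- r) r + cint g r s.
  move=> cg; have s1 : - s <= - r by lra.
  have s2 : - r <= s by lra.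
  have s3 : - r <= r by lra.
  have cg' : scont g (- r) s by apply: scont_sub cg; lra.
  by rewrite (cint_chasles s1 s2 cg) (cint_chasles s3 rs cg') addrA.
have H1 : scont (fun x => h (x +i* - s)) (- s) s.
  by apply: (@scont_hor _ h) => x kx; apply: ch => //; rewrite a1 orbT.
have H2 : scont (fun x => h (x +i* s)) (- s) s.
  by apply: (@scont_hor _ h) => x kx; apply: ch => //; rewrite a2 orbT.
have V1 : scont (fun x => h (- r +i* x)) (- s) s.
  by apply: (@scont_ver _ h) => x kx; apply: ch => //; rewrite a3.
have V2 : scont (fun x => h (r +i* x)) (- s) s.
  by apply: (@scont_ver _ h) => x kx; apply: ch => //; rewrite a4.
move: z1 z2 z3 z4; rewrite /rectint /hint /vint.
rewrite !(chasles3 _ H1) !(chasles3 _ H2) !(chasles3 _ V1) !(chasles3 _ V2).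
move=> z1 z2 z3 z4.
exact: annulus_edges z1 z2 z3 z4.
Qed.

(** The integral is 2 pi i, but a lower bound is enough for an estimate. Each edge has length 2 r
    and contributes at least 1 to the imaginary part, as r / (x^2 + r^2) is at least 1 / (2 r) on
    it. *)
Lemma nrm_rectint_inv (r : R) : 0 < r -> 4 <= nrm (rectint (fun z : C => z^-1) (- r) r (- r) r).
Proof.
move=> r0.
have rr : - r <= r by lra.
have e x : - r <= x <= r -> x ^+ 2 <= r ^+ 2.
  by move=> /andP[? ?]; rewrite -subr_ge0 subr_sqr mulr_ge0 //; lra.
have r2 : 0 < r ^+ 2 by rewrite exprn_gt0.
have low x : - r <= x <= r -> (2 * r)^-1 <= r / (x ^+ 2 + r ^+ 2).
  move=> /e xr; have x2 := sqr_ge0 x.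
  rewrite ler_pdivlMr; last lra.
  rewrite mulrC ler_pdivrMr; last lra.
  by rewrite mulrA mulrAC -expr2; lra.
have cV x y : (x != 0) || (y != 0) -> ccont (fun z : C => z^-1) (x +i* y).
  move=> xy; apply: (cdiff_cont (d := - ((x +i* y)^-1 * (x +i* y)^-1))); apply: cdiffV.
  by rewrite eq_complex /= negb_and.
have rn : r != 0 by rewrite gt_eqF.
have nrn : - r != 0 by rewrite oppr_eq0.
have H1 : scont (fun x => (x +i* - r)^-1) (- r) r.
  by apply: (@scont_hor _ (fun z : C => z^-1)) => x _; apply: cV; rewrite nrn orbT.
have H2 : scont (fun x => (x +i* r)^-1) (- r) r.
  by apply: (@scont_hor _ (fun z : C => z^-1)) => x _; apply: cV; rewrite rn orbT.
have V1 : scont (fun x => (- r +i* x)^-1) (- r) r.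
  by apply: (@scont_ver _ (fun z : C => z^-1)) => x _; apply: cV; rewrite nrn.
have V2 : scont (fun x => (r +i* x)^-1) (- r) r.
  by apply: (@scont_ver _ (fun z : C => z^-1)) => x _; apply: cV; rewrite rn.
have one f : rcont f (- r) r -> (forall x, - r <= x <= r -> (2 * r)^-1 <= f x) -> 1 <= rint f (- r) r.
  move=> cf hf; have -> : 1 = rint (fun=> (2 * r)^-1) (- r) r by rewrite rint_cst //; field.
  by apply: rint_le => // x _; exact: cvg_cst.
have none f : rcont f (- r) r -> (forall x, - r <= x <= r -> f x <= - (2 * r)^-1) -> rint f (- r) r <= - 1.
  move=> cf hf; have -> : - 1 = rint (fun=> - (2 * r)^-1) (- r) r by rewrite rint_cst //; field.
  by apply: rint_le => // x _; exact: cvg_cst.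
have b1 := one _ (scont_Im H1); have b2 := none _ (scont_Im H2).
have b3 := one _ (scont_Re V2); have b4 := none _ (scont_Re V1).
apply: le_trans (ler_Im_nrm _); apply: le_trans (ler_norm _).
rewrite /rectint /hint /vint /cint /= mul0r mul1r add0r.
have {}b1 : 1 <= rint (fun x => complex.Im (x +i* - r)^-1) (- r) r.
  by apply: b1 => x kx /=; rewrite sqrrN -mulNr opprK; exact: low.
have {}b2 : rint (fun x => complex.Im (x +i* r)^-1) (- r) r <= - 1.
  by apply: b2 => x kx /=; rewrite lerN2; exact: low.
have {}b3 : 1 <= rint (fun x => complex.Re (r +i* x)^-1) (- r) r.
  by apply: b3 => x kx /=; rewrite addrC; exact: low.
have {}b4 : rint (fun x => complex.Re (- r +i* x)^-1) (- r) r <= - 1.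
  by apply: b4 => x kx /=; rewrite sqrrN addrC mulNr lerN2; exact: low.
by move: b1 b2 b3 b4 => /=; lra.
Qed.

(* The odd function [k z = h z - h (- z)] has [k 0 = 0], so that its integral
   divided by z^2 over a small square is close to [2 d] times the integral of
   1 / z; no residue of 1 / z^2 has to be computed. *)
Theorem cauchy_estimate h (d : C) (s M : R) : 0 < s ->
  (forall z, nrm z <= 2 * s -> exists d, cdiff h z d) ->
  (forall z, nrm z <= 2 * s -> nrm (h z) <= M) ->
  cdiff h 0 d -> nrm d <= 4 * M / s.
Proof.
move=> s0 hd hM d0.
have sq (x y : R) : - s <= x <= s -> - s <= y <= s -> nrm (x +i* y) <= 2 * s.
  move=> kx ky; apply: le_trans (nrm_le_ReIm _) _ => /=.
  have : `|x| <= s by rewrite ler_norml.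
  have : `|y| <= s by rewrite ler_norml.
  by lra.
pose k z := h z - h (- z).
have kd z a b : cdiff h z a -> cdiff h (- z) b -> cdiff k z (a + b).
  move=> ha hb e e0; have e2 : 0 < e / 2 by lra.
  have [r1 r10 h1] := ha _ e2; have [r2 r20 h2] := hb _ e2.
  exists (Num.min r1 r2); first by rewrite lt_min r10.
  move=> u; rewrite lt_min => /andP[/h1 k1 u2].
  have := h2 (- u); rewrite nrmN => /(_ u2) k2.
  have -> : k (z + u) - k z - (a + b) * u =
    (h (z + u) - h z - a * u) - (h (- z - u) - h (- z) - b * - u).
    by rewrite /k opprD; ring.
  by apply: le_trans (nrmD _ _) _; rewrite nrmN; lra.
have k0 : cdiff k 0 (d + d) by apply: kd => //; rewrite oppr0.
have kM z : nrm z <= 2 * s -> nrm (k z) <= 2 * M.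
  move=> zs; apply: le_trans (nrmD _ _) _.
  by have := hM z zs; have := hM (- z); rewrite !nrmN => /(_ zs); lra.
pose G z := k z * (z^-1 * z^-1).
have Gd (x y : R) : - s <= x <= s -> - s <= y <= s -> x +i* y != 0 -> exists d, cdiff G (x +i* y) d.
  move=> kx ky z0; have zs := sq _ _ kx ky.
  have nzs : nrm (- (x +i* y)) <= 2 * s by rewrite nrmN.
  have [a ha] := hd _ zs; have [b hb] := hd _ nzs.
  by have v := cdiffV z0; eexists; exact: (cdiffM (kd _ _ _ ha hb) (cdiffM v v)).
have edge (t : R) : 0 < t -> t <= s -> edge_cont G (- t) t (- t) t.
  move=> t0 ts.
  have c x y : - t <= x <= t -> - t <= y <= t -> (x != 0) || (y != 0) -> ccont G (x +i* y).
    move=> /andP[? ?] /andP[? ?] xy; have [||| b /cdiff_cont //] := Gd x y.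
    - by apply/andP; split; lra.
    - by apply/andP; split; lra.
    - by rewrite eq_complex /= negb_and.
  have t1 : - t <= - t <= t by apply/andP; split; lra.
  have t2 : - t <= t <= t by apply/andP; split; lra.
  have n1 : t != 0 by rewrite gt_eqF.
  have n2 : - t != 0 by rewrite oppr_eq0.
  split; [apply: (@scont_hor _ G)|apply: (@scont_hor _ G)
    |apply: (@scont_ver _ G)|apply: (@scont_ver _ G)] => x kx; apply: c => //;
    by rewrite ?n1 ?n2 ?orbT.
have M0 : 0 <= M by apply: le_trans (hM 0 _); rewrite ?nrm_ge0 // nrm0; lra.
have far (x y t : R) : 0 < t -> `|x| = t \/ `|y| = t -> t <= nrm (x +i* y).
  move=> t0 [<-|<-]; [exact: (ler_Re_nrm (x +i* y))|exact: (ler_Im_nrm (x +i* y))].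
have nt (t : R) : 0 < t -> `|- t| = t by move=> t0; rewrite normrN gtr0_norm.
have pt (t : R) : 0 < t -> `|t| = t by move=> t0; rewrite gtr0_norm.
have nt' (t : R) : 0 < t -> - t <= t by move=> t0; lra.
have big : nrm (rectint G (- s) s (- s) s) <= 32 * M / s.
  have b x y : - s <= x <= s -> - s <= y <= s -> `|x| = s \/ `|y| = s ->
      nrm (G (x +i* y)) <= 2 * M / s ^+ 2.
    move=> kx ky xy; have f := far _ _ _ s0 xy.
    rewrite /G !nrmM nrmV -invfM -expr2.
    apply: ler_pM; rewrite ?nrm_ge0 ?invr_ge0 ?exprn_ge0 ?nrm_ge0 ?kM ?sq //.
    rewrite lef_pV2 ?posrE ?exprn_gt0 //; last by apply: lt_le_trans f.
    by rewrite lerXn2r ?nnegrE ?nrm_ge0 // ltW.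
  have ss := nt' _ s0.
  apply: (@le_trans _ _ (4 * (2 * M / s ^+ 2) * (s - - s + (s - - s)))).
    apply: rectint_bound => //; first exact: edge.
      by move=> x kx; split; apply: b; rewrite ?lexx ?ss //; right; rewrite ?nt ?pt.
    by move=> x kx; split; apply: b; rewrite ?lexx ?ss //; left; rewrite ?nt ?pt.
  by rewrite le_eqVlt; apply/orP; left; apply/eqP; field; rewrite gt_eqF.
(* The 8 is the 2 of [d + d] times the bound 4 of [nrm_rectint_inv]; the outer square gives 32 M /
   s, and 16 e is the error on a small square. *)
suff key (e : R) : 0 < e -> nrm d * 8 <= 32 * M / s + 16 * e.
  have : nrm d * 8 <= 32 * M / s.
    by apply/ler_addgt0Pr => e e0; have := key (e / 16); rewrite divr_gt0 // => /(_ isT); lra.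
  have -> : 32 * M / s = (4 * M / s) * 8 by ring.
  by rewrite ler_pM2r.
move=> e0; have [t t0 ht] := k0 _ e0.
(* On the square of half side [r] one has |z| <= 2 r < t, so that the expansion of [k] at 0 is valid
   there. *)
pose r := Num.min s (t / 3).
have r0 : 0 < r by rewrite lt_min s0; lra.
have rs : r <= s by rewrite ge_min lexx.
have rt : r <= t / 3 by rewrite ge_min lexx orbT.
have [G1 G2 G3 G4] := edge _ r0 rs.
rewrite (annulus_rectint r0 rs Gd) in big.
have cI : edge_cont (fun z : C => z^-1) (- r) r (- r) r.
  have c x y : (x != 0) || (y != 0) -> ccont (fun z : C => z^-1) (x +i* y).
    move=> xy; apply: (cdiff_cont (d := - ((x +i* y)^-1 * (x +i* y)^-1))); apply: cdiffV.
    by rewrite eq_complex /= negb_and.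
  have n1 : r != 0 by rewrite gt_eqF.
  have n2 : - r != 0 by rewrite oppr_eq0.
  split; [apply: (@scont_hor _ (fun z : C => z^-1))|apply: (@scont_hor _ (fun z : C => z^-1))
    |apply: (@scont_ver _ (fun z : C => z^-1))|apply: (@scont_ver _ (fun z : C => z^-1))] => x kx;
    by apply: c; rewrite ?n1 ?n2 ?orbT.
(* This is (k z - 2 d z) / z^2, which is at most e / r on the edges of the small square. *)
pose H z := G z + (- (d + d)) * z^-1.
have [I1 I2 I3 I4] := cI.
have cH : edge_cont H (- r) r (- r) r by split; apply: scontD => //; apply: scontZ.
have HE : rectint H (- r) r (- r) r =
    rectint G (- r) r (- r) r + (- (d + d)) * rectint (fun z : C => z^-1) (- r) r (- r) r.
  by rewrite /H rectintD ?rectintZ //; split => //; exact: scontZ.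
have rr := nt' _ r0.
have small : nrm (rectint H (- r) r (- r) r) <= 16 * e.
  have b x y : - r <= x <= r -> - r <= y <= r -> `|x| = r \/ `|y| = r ->
      nrm (H (x +i* y)) <= e / r.
    move=> kx ky xy; have f := far _ _ _ r0 xy.
    have z0 : x +i* y != 0 by apply: contraTneq f => ->; rewrite nrm0 -ltNge.
    have zr : nrm (x +i* y) < t.
      apply: le_lt_trans (nrm_le_ReIm _) _ => /=.
      have : `|x| <= r by rewrite ler_norml.
      have : `|y| <= r by rewrite ler_norml.
      by lra.
    have := ht _ zr; have -> : k 0 = 0 by rewrite /k oppr0 subrr.
    rewrite add0r subr0 => kz.
    have -> : H (x +i* y) = (k (x +i* y) - (d + d) * (x +i* y)) * ((x +i* y)^-1 * (x +i* y)^-1).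
      by rewrite /H /G; move: (x +i* y) z0 => z z0; field.
    rewrite nrmM; apply: (@le_trans _ _ (e * nrm (x +i* y) * nrm ((x +i* y)^-1 * (x +i* y)^-1))).
      by rewrite ler_wpM2r ?nrm_ge0.
    rewrite nrmM nrmV -mulrA ler_wpM2l ?(ltW e0) //.
    rewrite mulVKf ?gt_eqF ?nrm_gt0 //.
    by rewrite lef_pV2 ?posrE ?nrm_gt0.
  apply: (@le_trans _ _ (4 * (e / r) * (r - - r + (r - - r)))).
    apply: rectint_bound => //.
      by move=> x kx; split; apply: b; rewrite ?lexx ?rr //; right; rewrite ?nt ?pt.
    by move=> x kx; split; apply: b; rewrite ?lexx ?rr //; left; rewrite ?nt ?pt.
  by rewrite le_eqVlt; apply/orP; left; apply/eqP; field; rewrite gt_eqF.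
have I4' := nrm_rectint_inv r0.
set I := rectint (fun z : C => z^-1) _ _ _ _ in HE I4'.
have : nrm ((d + d) * I) <= 32 * M / s + 16 * e.
  have -> : (d + d) * I = rectint G (- r) r (- r) r - rectint H (- r) r (- r) r.
    by rewrite HE mulNr opprD opprK addrA subrr add0r.
  by apply: le_trans (nrmD _ _) _; rewrite nrmN; lra.
have n2 : nrm (2 : C) = 2.
  by rewrite -[2]/(2%:R) -(rmorph_nat (real_complex R)) nrm_real gtr0_norm.
have -> : d + d = 2 * d by ring.
by rewrite !nrmM n2; apply: le_trans; have := nrm_ge0 d; nra.
Qed.

End CauchyEstimate.

(** * Taylor estimates for holomorphic functions *)

Section Regularity.
Local Open Scope complex_scope.
Variable R : realType.
Local Notation C := R[i].
Variable V : normedModType R[i].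
Implicit Types F G : V -> C.

Lemma real_is_derive (f : R -> R) (x l : R) :
  (forall e : R, 0 < e -> exists2 d : R, 0 < d &
     forall u : R, `|u| < d -> `|f (x + u) - f x - l * u| <= e * `|u|) ->
  is_derive x 1 f l.
Proof.
move=> h.
have c : (fun t : R => t^-1 *: ((f \o shift x) (t *: 1) - f x)) @ 0^' --> l.
  apply/cvgrPdist_le => e e0; have [d d0 hd] := h _ e0.
  near=> t; have t0 : t != 0 by near: t; exact: nbhs_dnbhs_neq.
  have td : `|t| < d.
    near: t; apply: dnbhs0_lt => //.
  have := hd t td; rewrite /= -[t *: 1]/(t * 1) mulr1 [t + x]addrC.
  rewrite -[_ *: _]/(t^-1 * (f (x + t) - f x)).
  have -> : l - t^-1 * (f (x + t) - f x) = - (t^-1 * (f (x + t) - f x - l * t)).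
    by field.
  move=> h1; rewrite normrN normrM normfV mulrC ler_pdivrMr ?normr_gt0 //.
split; first by apply/cvg_ex; exists l.
by apply/cvg_lim.
Unshelve. all: by end_near. Qed.

Lemma real_mean_value (f g : R -> R) (L : R) :
  (forall x : R, 0 <= x <= 1 -> is_derive x 1 f (g x)) ->
  (forall x : R, 0 <= x <= 1 -> `|g x| <= L) -> `|f 1 - f 0| <= L.
Proof.
move=> fg gL.
have [c] : exists2 c, c \in `]0, 1[%R & f 1 - f 0 = g c * (1 - 0).
  apply: MVT => //.
    by move=> x; rewrite in_itv /= => /andP[? ?]; apply: fg; apply/andP; split; lra.
  apply: continuous_in_subspaceT => x; rewrite inE /= in_itv /= => kx.
  apply/differentiable_continuous/derivable1_diffP.
  by have [] := fg x kx.
rewrite in_itv /= => /andP[? ?] ->; rewrite subr0 mulr1; apply: gL.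
by apply/andP; split; lra.
Qed.

Definition homog (T : V -> C) := forall a u, T (a *: u) = a * T u.

Lemma fdiff_line F (T : V -> C) (x u : V) (z : C) : homog T -> fdiff F (x + z *: u) T ->
  cdiff (fun w => F (x + w *: u)) z (T u).
Proof.
move=> hT hF e e0; have U0 := nrm_ge0 u.
have u1 : 0 < nrm u + 1 by lra.
have [d d0 hd] := hF _ (divr_gt0 e0 u1).
exists (d / (nrm u + 1)); first by rewrite divr_gt0.
move=> w; rewrite ltr_pdivlMr // => wd.
have wu : nrm (w *: u) < d.
  by rewrite nrmZ; apply: le_lt_trans wd; rewrite ler_wpM2l ?nrm_ge0 //; lra.
have := hd _ wu; rewrite hT [w * T u]mulrC -[x + _ + _]addrA -scalerDl => h.
apply: le_trans h _; rewrite nrmZ -mulrA ler_wpM2l ?(ltW e0) //.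
rewrite mulrC ler_pdivrMr // ler_wpM2l ?nrm_ge0 //; lra.
Qed.

(** The real mean value theorem is applied along the segment to the real and to the imaginary part,
    hence the factor 2. *)
Lemma mean_value F (T : V -> V -> C) (x u : V) (L : R) :
  (forall t : R, 0 <= t <= 1 -> homog (T (x + t%:C *: u)) /\
    fdiff F (x + t%:C *: u) (T (x + t%:C *: u))) ->
  (forall t : R, 0 <= t <= 1 -> nrm (T (x + t%:C *: u) u) <= L) ->
  nrm (F (x + u) - F x) <= 2 * L.
Proof.
move=> hF hL.
pose g (t : R) : C := F (x + t%:C *: u).
pose g' (t : R) : C := T (x + t%:C *: u) u.
have gd (t : R) : 0 <= t <= 1 -> forall e : R, 0 < e -> exists2 d : R, 0 < d &
    forall s : R, `|s| < d -> nrm (g (t + s) - g t - g' t * s%:C) <= e * `|s|.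
  move=> kt e e0; have [hT hFt] := hF t kt.
  have [d d0 hd] := fdiff_line hT hFt e0; exists d => // s sd.
  have := hd s%:C; rewrite nrm_real => /(_ sd).
  by rewrite /g /g' rmorphD.
have bR : `|complex.Re (g 1) - complex.Re (g 0)| <= L.
  apply: (@real_mean_value (fun t => complex.Re (g t)) (fun t => complex.Re (g' t))) => t kt; last first.
    by apply: le_trans (ler_Re_nrm _) _; exact: hL.
  apply: real_is_derive => e e0; have [d d0 hd] := gd t kt e e0; exists d => // s /hd.
  apply: le_trans; apply: le_trans (ler_Re_nrm _).
  rewrite !raddfB /=; case: (g' t) => a b /=; by rewrite mulr0 subr0.
have bI : `|complex.Im (g 1) - complex.Im (g 0)| <= L.
  apply: (@real_mean_value (fun t => complex.Im (g t)) (fun t => complex.Im (g' t))) => t kt; last first.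
    by apply: le_trans (ler_Im_nrm _) _; exact: hL.
  apply: real_is_derive => e e0; have [d d0 hd] := gd t kt e e0; exists d => // s /hd.
  apply: le_trans; apply: le_trans (ler_Im_nrm _).
  rewrite !raddfB /=; case: (g' t) => a b /=; by rewrite mulr0 add0r.
have -> : F (x + u) - F x = g 1 - g 0 by rewrite /g scale1r scale0r addr0.
apply: le_trans (nrm_le_ReIm _) _; rewrite !raddfB /=; lra.
Qed.

(** Cauchy's estimate on the complex line through [x] in direction [u]. With s = r / (8 |u|) the
    disc of radius 2 s is mapped to distance at most r / 4 from [x], hence into the ball around
    [p]. *)
Lemma derivative_bound F (T : V -> V -> C) (p : V) (r M : R) : 0 < r ->
  (forall x : V, nrm (x - p) < r -> [/\ homog (T x), fdiff F x (T x) & nrm (F x) <= M]) ->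
  forall x u : V, nrm (x - p) < r / 2 -> nrm (T x u) <= 32 * M / r * nrm u.
Proof.
move=> r0 hF x u xp.
have inb (y : V) : nrm (y - x) < r / 2 -> nrm (y - p) < r.
  move=> yx; have -> : y - p = (y - x) + (x - p) by rewrite addrA subrK.
  by apply: le_lt_trans (nrmD _ _) _; lra.
have [->|u0] := eqVneq u 0.
  have [|hT _ _] := hF x; first by lra.
  have T0 : T x 0 = 0 by rewrite -(scale0r (0 : V)) hT mul0r.
  by rewrite T0 !nrm0 mulr0.
have U0 := nrm_gt0 u0.
pose s := r / (8 * nrm u).
have s0 : 0 < s by rewrite divr_gt0 // mulr_gt0.
have line (z : C) : nrm z <= 2 * s -> nrm (x + z *: u - p) < r.
  move=> zs; apply: inb; rewrite addrAC subrr add0r nrmZ.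
  apply: (@le_lt_trans _ _ (2 * s * nrm u)); first by rewrite ler_wpM2r ?nrm_ge0.
  by have -> : 2 * s * nrm u = r / 4 by [rewrite /s; field; rewrite gt_eqF]; lra.
have := @cauchy_estimate _ (fun z => F (x + z *: u)) (T x u) s M s0.
have -> : 4 * M / s = 32 * M / r * nrm u by rewrite /s; field; rewrite !gt_eqF.
apply.
- move=> z /line /hF[hT hFz _]; exists (T (x + z *: u) u); exact: fdiff_line.
- by move=> z /line /hF[].
- have [|hT hFx _] := hF (x + (0 : C) *: u).
    by apply: line; rewrite nrm0; lra.
  by have := fdiff_line hT hFx; rewrite scale0r addr0.
Qed.

Lemma fdiff_shift F (T : V -> C) (x u : V) : fdiff F (x + u) T -> fdiff (fun y => F (y + u)) x T.
Proof.
by move=> hF e e0; have [d d0 hd] := hF e e0; exists d => // v /hd; rewrite [x + u + v]addrAC.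
Qed.

Lemma fdiffB F G (T S : V -> C) (x : V) : fdiff F x T -> fdiff G x S ->
  fdiff (fun y => F y - G y) x (fun u => T u - S u).
Proof.
move=> hF hG e e0; have e2 : 0 < e / 2 by lra.
have [d1 d10 h1] := hF _ e2; have [d2 d20 h2] := hG _ e2.
exists (Num.min d1 d2); first by rewrite lt_min d10.
move=> u; rewrite lt_min => /andP[/h1 k1 /h2 k2].
have -> : F (x + u) - G (x + u) - (F x - G x) - (T u - S u) =
  (F (x + u) - F x - T u) - (G (x + u) - G x - S u) by ring.
by apply: le_trans (nrmD _ _) _; rewrite nrmN; lra.
Qed.

Lemma fdiff_additive (T : V -> C) (x : V) : {morph T : u v / u + v} -> fdiff T x T.
Proof.
move=> TD e e0; exists 1 => // u _.
have -> : T (x + u) - T x - T u = 0 by rewrite TD; ring.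
by rewrite nrm0 mulr_ge0 ?nrm_ge0 // ltW.
Qed.

(* Cauchy's estimate bounds the derivative of F, hence makes F Lipschitz;
   applied again to the increments [y |-> F (y + u) - F y], which are therefore
   O(u), it makes the derivative Lipschitz. *)
Theorem holomorphic_taylor F (T : V -> V -> C) (p : V) (r M : R) : 0 < r ->
  (forall x, homog (T x)) -> (forall x, {morph T x : u v / u + v}) ->
  (forall x : V, nrm (x - p) < r -> fdiff F x (T x) /\ nrm (F x) <= M) ->
  exists2 K : R, 0 <= K & forall x u : V, nrm (x - p) < r / 16 -> nrm u < r / 16 ->
    [/\ forall v, nrm (T x v) <= K * nrm v,
        forall v, nrm (T (x + u) v - T x v) <= K * nrm u * nrm v
      & nrm (F (x + u) - F x - T x u) <= K * nrm u ^+ 2].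
Proof.
move=> r0 hT TD hF.
have M0 : 0 <= M.
  by have [|_] := hF p; [rewrite subrr nrm0|apply: le_trans; exact: nrm_ge0].
have seg (x u : V) (t s : R) : 0 <= t <= 1 -> nrm (x - p) < s -> nrm (x + u - p) < s ->
    nrm (x + t%:C *: u - p) < s.
  move=> /andP[t0 t1] h1 h2.
  have -> : x + t%:C *: u - p = (1 - t)%:C *: (x - p) + t%:C *: (x + u - p).
    rewrite [x + u - p]addrAC rmorphB rmorph1 scalerBl scale1r.
    by rewrite [t%:C *: (x - p + u)]scalerDr addrA subrK addrAC.
  apply: le_lt_trans (nrmD _ _) _; rewrite !nrmZ !nrm_real !ger0_norm ?subr_ge0 //.
  have : (1 - t) * nrm (x - p) <= (1 - t) * Num.max (nrm (x - p)) (nrm (x + u - p)).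
    by rewrite ler_wpM2l ?subr_ge0 // le_max lexx.
  have : t * nrm (x + u - p) <= t * Num.max (nrm (x - p)) (nrm (x + u - p)).
    by rewrite ler_wpM2l // le_max lexx orbT.
  have : Num.max (nrm (x - p)) (nrm (x + u - p)) < s by rewrite gt_max h1 h2.
  by lra.
have b1 : forall x u : V, nrm (x - p) < r / 2 -> nrm (T x u) <= 32 * M / r * nrm u.
  by apply: (@derivative_bound F) => // x /hF[].
pose L := 2 * (32 * M / r).
have L0 : 0 <= L by rewrite /L !mulr_ge0 ?invr_ge0 // ltW.
have lip (x u : V) : nrm (x - p) < r / 2 -> nrm (x + u - p) < r / 2 ->
    nrm (F (x + u) - F x) <= L * nrm u.
  move=> hx hu; rewrite /L -mulrA; apply: (@mean_value F T) => t kt.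
    by split=> //; have [|] := hF (x + t%:C *: u); [have := seg _ _ _ _ kt hx hu; lra|].
  by apply: b1; exact: seg.
(* The constant of [derivative_bound] on a ball of radius r / 4, for increments bounded by
   [L * nrm u]. *)
pose K1 := 32 * L / (r / 4).
have K10 : 0 <= K1 by rewrite /K1 !mulr_ge0 ?invr_ge0 ?divr_ge0 // ltW.
have tri (x u : V) (a b : R) : nrm (x - p) < a -> nrm u < b -> nrm (x + u - p) < a + b.
  by move=> h1 h2; rewrite addrAC; apply: le_lt_trans (nrmD _ _) _; lra.
have b2 (x u v : V) : nrm (x - p) < r / 8 -> nrm u < r / 4 ->
    nrm (T (x + u) v - T x v) <= K1 * nrm u * nrm v.
  move=> hx hu.
  have := @derivative_bound (fun y => F (y + u) - F y) (fun y w => T (y + u) w - T y w)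
    p (r / 4) (L * nrm u).
  have -> : r / 4 / 2 = r / 8 by field.
  have -> : 32 * (L * nrm u) / (r / 4) = K1 * nrm u by rewrite /K1; ring.
  apply => //; first lra.
  move=> y hy; have hyu := tri _ _ _ _ hy hu; split.
  - by move=> a w; rewrite !hT mulrBr.
  - apply: fdiffB; first by apply: fdiff_shift; have [] := hF (y + u); [lra|].
    by have [] := hF y; [lra|].
  - by apply: lip; lra.
have K20 : 0 <= 32 * M / r by rewrite !mulr_ge0 ?invr_ge0 // ltW.
exists (2 * K1 + 32 * M / r); first lra.
move=> x u hx hu; split.
- move=> v; apply: le_trans (b1 _ _ _) _; first lra.
  by rewrite ler_wpM2r ?nrm_ge0 //; lra.
- move=> v; apply: le_trans (b2 _ _ _ _ _) _; [lra|lra|].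
  by do 2 (rewrite ler_wpM2r ?nrm_ge0 //); lra.
(* The mean value bound is applied to F - T x, whose derivative T y - T x is O(u) on the segment. *)
have E : F (x + u) - F x - T x u = (F (x + u) - T x (x + u)) - (F x - T x x).
  by rewrite TD; ring.
rewrite E; apply: (@le_trans _ _ (2 * (K1 * nrm u ^+ 2))); last first.
  by rewrite mulrA ler_wpM2r ?sqr_ge0 //; lra.
apply: (@mean_value (fun y => F y - T x y) (fun y w => T y w - T x w)) => t kt.
  split; first by move=> a w; rewrite !hT mulrBr.
  apply: fdiffB; last exact: fdiff_additive.
  have [] := hF (x + t%:C *: u) => //.
  by have := tri _ _ _ _ hx hu => k; apply: (@lt_trans _ _ (r / 8)); [apply: seg kt _ _; lra|lra].
have tu : nrm (t%:C *: u) <= nrm u.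
  move: kt => /andP[t0 t1]; rewrite nrmZ nrm_real ger0_norm //.
  by rewrite -[leRHS]mul1r ler_wpM2r ?nrm_ge0.
apply: le_trans (b2 _ _ _ _ _) _; [lra|lra|].
by rewrite expr2 mulrA ler_wpM2r ?nrm_ge0 // ler_wpM2l.
Qed.

End Regularity.

(** * Images of maps with everywhere singular differential *)

Section Sard.
Local Open Scope complex_scope.
Variable R : realType.
Local Notation C := R[i].

(** The left side counts codes (cube, offsets in [k] complex coordinates, two residues) and grows
    like L^(4k+2); the number of grid points on the right is L^(4k+4). *)
Lemma grid_count (k c b d : nat) : exists L0, forall L, (L0 <= L)%N ->
  ((2 * c * L).+1 ^ (2 * k.+1) * (2 * b * L).+1 ^ (2 * k) * d.+1 ^ 2 < (L ^ 2) ^ (2 * k.+1))%N.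
Proof.
pose K := ((2 * c).+1 ^ (2 * k.+1) * (2 * b).+1 ^ (2 * k) * d.+1 ^ 2)%N.
exists K.+1 => L KL; have L0 : (0 < L)%N by apply: leq_trans KL.
have le1 a n : ((2 * a * L).+1 ^ n <= ((2 * a).+1 * L) ^ n)%N.
  have [->|n0] := posnP n; first by rewrite !expn0.
  by rewrite leq_exp2r // mulSn; nia.
apply: (@leq_ltn_trans (K * L ^ (4 * k + 2))).
  have -> : (K * L ^ (4 * k + 2) = ((2 * c).+1 * L) ^ (2 * k.+1) * ((2 * b).+1 * L) ^ (2 * k) * d.+1 ^ 2)%N.
    rewrite !expnMn /K (_ : (4 * k + 2 = 2 * k.+1 + 2 * k)%N); last lia.
    by rewrite expnD; ring.
  by rewrite leq_mul2r leq_mul ?orbT.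
have -> : ((L ^ 2) ^ (2 * k.+1) = L ^ 2 * L ^ (4 * k + 2))%N.
  by rewrite -expnM -expnD; congr (_ ^ _)%N; lia.
rewrite ltn_mul2r expn_gt0 L0 /=; apply: (leq_trans KL).
by rewrite expnS expn1 leq_pmulr.
Qed.

(** A coordinate known up to an error [d] can be recorded by its residue, which costs a number of
    codes independent of L. *)
Lemma eq_modn_close (a b d : nat) : (a <= b + d)%N -> (b <= a + d)%N ->
  a = b %[mod d.+1] -> a = b.
Proof.
wlog ab : a b / (a <= b)%N => [h h1 h2 h3|_ h2 h3].
  by have [ab|/ltnW ba] := leqP a b; [exact: h|apply/esym/h].
have : (d.+1 %| b - a)%N by rewrite -eqn_mod_dvd // h3.
by move/dvdnP => [[|q]]; rewrite ?mulSn; [lia|move: (q * _)%N => w; lia].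
Qed.

Lemma shift_subn_lt (a h c : nat) : (a <= h + c)%N -> (a + c - h < (2 * c).+1)%N.
Proof. lia. Qed.

(** Signed offsets from [h] are stored as naturals after a shift by [c]; the hypotheses keep the
    subtraction from being truncated. *)
Lemma shift_subn_inj (a b h c : nat) : (h <= a + c)%N -> (h <= b + c)%N ->
  (a + c - h = b + c - h)%N -> a = b.
Proof. lia. Qed.

Lemma Re_entry k (u : 'rV[C]_k) j : `|complex.Re (u 0 j)| <= nrm u.
Proof. by apply: le_trans (nrm_entry u j); exact: ler_Re_nrm. Qed.

Lemma Im_entry k (u : 'rV[C]_k) j : `|complex.Im (u 0 j)| <= nrm u.
Proof. by apply: le_trans (nrm_entry u j); exact: ler_Im_nrm. Qed.

Definition part (b : bool) (z : C) : R := if b then complex.Im z else complex.Re z.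

Lemma part_entry k (u : 'rV[C]_k) j b : `|part b (u 0 j)| <= nrm u.
Proof. by case: b; [exact: Im_entry|exact: Re_entry]. Qed.

Lemma part_le b (z : C) : `|part b z| <= nrm z.
Proof. by case: b; [exact: ler_Im_nrm|exact: ler_Re_nrm]. Qed.

Lemma partB b (z w : C) : part b (z - w) = part b z - part b w.
Proof. by case: b; rewrite /part raddfB. Qed.

Lemma nrm_parts k (u : 'rV[C]_k) (e : R) : 0 <= e ->
  (forall j b, `|part b (u 0 j)| <= e) -> nrm u <= 2 * e.
Proof.
move=> e0 h; apply: nrm_rV; first lra.
move=> j; apply: le_trans (nrm_le_ReIm _) _.
by have := h j false; have := h j true; rewrite /part; lra.
Qed.

(** A vector annihilated by [J] is normalized at its largest entry. The entry [j0] of a vector can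
    then be bounded from the pairing with [nu] and the other entries. *)
Lemma singular_covector k (J : 'M[C]_k.+1) : \det J = 0 ->
  exists nu : 'I_k.+1 -> C, exists j0, [/\ nu j0 = 1, forall j, nrm (nu j) <= 1
    & forall u : 'rV_k.+1, \sum_j (u *m J) 0 j * nu j = 0].
Proof.
move=> dJ; have /eqP/det0P[v v0 vJ] : \det J^T = 0 by rewrite det_tr.
pose j0 := [arg max_(j > ord0) nrm (v 0 j)]%O.
have mx j : nrm (v 0 j) <= nrm (v 0 j0).
  by rewrite /j0; case: arg_maxP => // i _; apply.
have p : 0 < nrm (v 0 j0).
  rewrite lt_def nrm_ge0 andbT; apply: contra_neq v0 => h0.
  apply/rowP => j; rewrite mxE; apply: nrm0_eq0; apply/le_anti.
  by rewrite nrm_ge0 andbT -h0 mx.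
have v00 : v 0 j0 != 0 by apply: contraTneq p => ->; rewrite nrm0 ltxx.
exists (fun j => v 0 j / v 0 j0), j0; split.
- by rewrite divff.
- by move=> j; rewrite nrmM nrmV ler_pdivrMr // mul1r.
move=> u; have : (u *m J *m v^T) 0 0 = 0.
  by rewrite -mulmxA -[J]trmxK -trmx_mul vJ trmx0 mulmx0 mxE.
rewrite mxE => h; under eq_bigr do rewrite mulrA.
rewrite -mulr_suml -[X in X * _](_ : 0 = _) ?mul0r // -[LHS]h.
by apply: eq_bigr => j _; rewrite [v^T j 0]mxE.
Qed.

(* Suppose the image meets a ball of radius about 1 / L^2 around each of the
   (L^2)^(2k+2) points of a grid. Sort these points by the cube of side 1 / L
   containing a chosen preimage: there are O(L^(2k+2)) cubes, and the points
   attached to one cube lie within O(1 / L^2) of a complex hyperplane and in a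
   ball of radius O(1 / L), so that there are O(L^(2k)) of them. *)
Lemma nowhere_dense_image k (X : set 'rV[C]_k.+1) (G : 'rV[C]_k.+1 -> 'rV[C]_k.+1)
    (J : 'rV[C]_k.+1 -> 'M[C]_k.+1) (c : nat) : (0 < c)%N ->
  (forall x, X x -> nrm x <= c%:R) ->
  (forall x, X x -> forall v : 'rV_k.+1, nrm (v *m J x) <= c%:R * nrm v) ->
  (forall x y, X x -> X y -> nrm (y - x) * c%:R < 1 ->
     nrm (G y - G x - (y - x) *m J x) <= c%:R * nrm (y - x) ^+ 2) ->
  (forall x, X x -> \det (J x) = 0) ->
  forall (y0 : 'rV[C]_k.+1) (r : R), 0 < r -> exists y1 : 'rV[C]_k.+1, exists r1 : R,
    [/\ 0 < r1, r1 <= r / 2, nrm (y1 - y0) <= r / 2 & forall x, X x -> r1 < nrm (G x - y1)].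
Proof.
move=> c0 Xc XJ XG Xdet y0 r r0.
have c1 : (1 : R) <= c%:R by rewrite ler1n.
(* Within one cube the images differ by at most 4 c / L, hence the grid indices by at most b L when
   the mesh is r / (4 L^2). *)
pose b := (Num.truncn (32 * c%:R / r)).+2.
have hb : 32 * c%:R / r + 1 <= b%:R.
  have := truncnS_gt (32 * c%:R / r); rewrite /b -[X in _ <= X%:R]addn1 natrD; lra.
(* Bounds, in units of the mesh, the uncertainty of coordinate [j0] left by the covector:
   second-order errors c / L^2 and the distances to the grid, both multiplied by k + 1. *)
pose d := (Num.truncn (64 * k.+1%:R * c%:R / r + k.+1%:R)).+1.
have hd : 64 * k.+1%:R * c%:R / r + k.+1%:R < d%:R by exact: truncnS_gt.
have [L0 hL0] := grid_count k c b d.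
(* L > 2 c makes points of one cube, at distance at most 2 / L, close enough for the second-order
   bound. *)
pose L := maxn L0 (2 * c).+1.
have LL0 : (L0 <= L)%N by rewrite leq_maxl.
have Lc : (2 * c < L)%N by rewrite leq_maxr.
have Lpos : (0 < L)%N by apply: leq_trans Lc.
have Lr : 0 < (L%:R : R) by rewrite ltr0n.
have Lc' : 2 * c%:R < (L%:R : R) by rewrite -natrM ltr_nat.
(* With L^2 steps per real coordinate the grid spans r / 4, hence stays within r / 2 of [y0] by
   [nrm_parts]. *)
pose eta := r / (4 * L%:R ^+ 2).
have eta0 : 0 < eta by rewrite divr_gt0 // mulr_gt0 // exprn_gt0.
have etaE : eta * L%:R ^+ 2 = r / 4 by rewrite /eta; field; rewrite gt_eqF.
pose gT := {ffun 'I_k.+1 * bool -> 'I_(L ^ 2)}.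
pose Y (g : gT) : 'rV[C]_k.+1 :=
  \row_j (y0 0 j + (eta * (g (j, false))%:R +i* (eta * (g (j, true))%:R))).
have Ypart g j s : part s (Y g 0 j) = part s (y0 0 j) + eta * (g (j, s))%:R.
  by rewrite /Y mxE; case: s; case: (y0 0 j).
have Yin g : nrm (Y g - y0) <= r / 2.
  have -> : r / 2 = 2 * (r / 4) by lra.
  apply: nrm_parts => [|j s]; first lra.
  rewrite entryB partB Ypart addrAC subrr add0r ger0_norm; last first.
    by rewrite mulr_ge0 ?ler0n ?(ltW eta0).
  rewrite -etaE ler_pM2l // -natrX ler_nat ltnW //.
apply: contrapT => no.
have L1 : (1 : R) <= L%:R by rewrite ler1n.
have near g : exists x, X x /\ nrm (G x - Y g) <= eta / 4.
  apply: contrapT => ng; apply: no; exists (Y g), (eta / 4); split; [lra| |exact: Yin|].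
    have : eta * 1 <= eta * L%:R ^+ 2 by rewrite ler_pM2l // expr_ge1.
    by rewrite etaE; lra.
  by move=> x Xx; rewrite ltNge; apply/negP => h; apply: ng; exists x.
have [xs hxs] := choice near.
have Xs g : X (xs g) by have [] := hxs g.
have Gs g : nrm (G (xs g) - Y g) <= eta / 4 by have [] := hxs g.
pose tr (g : gT) (p : 'I_k.+1 * bool) := Num.truncn ((part p.2 (xs g 0 p.1) + c%:R) * L%:R).
have pos g p : 0 <= (part p.2 (xs g 0 p.1) + c%:R) * L%:R.
  rewrite mulr_ge0 ?ler0n //; have := le_trans (part_entry (xs g) p.1 p.2) (Xc _ (Xs g)).
  by rewrite ler_norml; lra.
have trb g p : (tr g p < (2 * c * L).+1)%N.
  rewrite ltnS -(ler_nat R); have /andP[+ _] := truncn_itv (pos g p).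
  move/le_trans; apply; rewrite natrM ler_pM2r // natrM.
  have := le_trans (part_entry (xs g) p.1 p.2) (Xc _ (Xs g)).
  by rewrite ler_norml; lra.
pose bx (g : gT) : {ffun 'I_k.+1 * bool -> 'I_(2 * c * L).+1} := [ffun p => Ordinal (trb g p)].
have bxclose g h : bx g = bx h -> nrm (xs g - xs h) <= 2 * L%:R^-1.
  move=> e; apply: nrm_parts => [|j s]; first by rewrite invr_ge0 ltW.
  have : tr g (j, s) = tr h (j, s).
    by have := congr1 (fun f : {ffun _ -> _} => val (f (j, s))) e; rewrite !ffunE.
  have /andP[] := truncn_itv (pos g (j, s)); have /andP[] := truncn_itv (pos h (j, s)).
  rewrite /tr /= => + + + + E; rewrite E; set n := Num.truncn _; rewrite -[n.+1]addn1 natrD.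
  move=> k1 k2 k3 k4; rewrite entryB partB -[leRHS]mul1r ler_pdivlMr //.
  by rewrite -[X in _ * X](ger0_norm (ltW Lr)) -normrM ler_norml mulrBl; apply/andP; split; lra.
have L2pos : (0 < L ^ 2)%N by rewrite expn_gt0 Lpos.
(* A reference grid point for each cube; the default value is reached only for cubes to which no
   grid point is attached. *)
pose rep (B : {ffun 'I_k.+1 * bool -> 'I_(2 * c * L).+1}) : gT :=
  odflt [ffun=> Ordinal L2pos] [pick g | bx g == B].
have repP g : bx (rep (bx g)) = bx g.
  by rewrite /rep; case: pickP => [h /eqP //|/(_ g)]; rewrite eqxx.
have cov g : exists nj : ('I_k.+1 -> C) * 'I_k.+1, [/\ nj.1 nj.2 = 1, forall j, nrm (nj.1 j) <= 1
    & forall u : 'rV_k.+1, \sum_j (u *m J (xs g)) 0 j * nj.1 j = 0].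
  by have [nu [j0 h]] := singular_covector (Xdet _ (Xs g)); exists (nu, j0).
have [NU hNU] := choice cov.
have Linv : L%:R^-1 * L%:R = 1 :> R by rewrite mulVf // gt_eqF.
have Li0 : 0 < (L%:R^-1 : R) by rewrite invr_gt0.
have cl : c%:R * L%:R^-1 <= 1 / 2 :> R.
  by rewrite ler_pdivrMr //; lra.
have delta g : let h := rep (bx g) in
    nrm (G (xs g) - G (xs h) - (xs g - xs h) *m J (xs h)) <= 4 * c%:R * L%:R^-1 ^+ 2
    /\ nrm (G (xs g) - G (xs h)) <= 4 * c%:R * L%:R^-1.
  move=> h; have close : nrm (xs g - xs h) <= 2 * L%:R^-1 by apply: bxclose; rewrite repP.
  have c2 : nrm (xs g - xs h) * c%:R < 1.
    apply: (@le_lt_trans _ _ (2 * L%:R^-1 * c%:R)); first by rewrite ler_wpM2r.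
    by rewrite mulrAC -ltr_pdivlMr ?invr_gt0 // invrK mul1r.
  have q1 := XG _ _ (Xs h) (Xs g) c2.
  have q2 := XJ _ (Xs h) (xs g - xs h).
  have s1 : nrm (G (xs g) - G (xs h) - (xs g - xs h) *m J (xs h)) <= 4 * c%:R * L%:R^-1 ^+ 2.
    apply: le_trans q1 _; have -> : 4 * c%:R * L%:R^-1 ^+ 2 = c%:R * (2 * L%:R^-1) ^+ 2 :> R by ring.
    by rewrite ler_wpM2l ?ler0n // lerXn2r ?nnegrE ?nrm_ge0 // mulr_ge0 // ltW.
  split=> //; rewrite -[G (xs g) - G (xs h)](subrK ((xs g - xs h) *m J (xs h))).
  apply: le_trans (nrmD _ _) _.
  have q3 : c%:R * nrm (xs g - xs h) <= c%:R * (2 * L%:R^-1) by rewrite ler_wpM2l ?ler0n.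
  have q4 : c%:R * L%:R^-1 * L%:R^-1 <= 1 / 2 * L%:R^-1 :> R by rewrite ler_wpM2r ?(ltW Li0).
  have q5 : 1 * L%:R^-1 <= c%:R * L%:R^-1 :> R by rewrite ler_wpM2r ?(ltW Li0).
  by move: s1 q2 q3 q4 q5; rewrite expr2; lra.
have Ydist g h : nrm (Y g - Y h) <= nrm (G (xs g) - G (xs h)) + eta / 2.
  have -> : Y g - Y h = (G (xs g) - G (xs h)) - ((G (xs g) - Y g) - (G (xs h) - Y h)).
    by rewrite !opprB; apply/rowP => j; rewrite !mxE; ring.
  apply: le_trans (nrmD _ _) _; rewrite nrmN.
  have := nrmD (G (xs g) - Y g) (- (G (xs h) - Y h)); rewrite nrmN.
  by have := Gs g; have := Gs h; lra.
have etaL : eta * L%:R = r / 4 * L%:R^-1 by rewrite -etaE expr2 -!mulrA mulfV ?mulr1 // gt_eqF.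
have rel g p : let h := rep (bx g) in (g p <= h p + b * L)%N /\ (h p <= g p + b * L)%N.
  move=> h.
  have : `|eta * (g p)%:R - eta * (h p)%:R| <= eta * (b * L)%:R.
    have -> : eta * (g p)%:R - eta * (h p)%:R = part p.2 ((Y g - Y h) 0 p.1).
      by case: p => j s; rewrite entryB partB !Ypart /=; ring.
    apply: le_trans (part_entry _ _ _) _; apply: le_trans (Ydist _ _) _.
    have [_ q] := delta g; rewrite -/h in q.
    have q1 : (32 * c%:R / r + 1) * (eta * L%:R) <= b%:R * (eta * L%:R).
      by rewrite ler_wpM2r // mulr_ge0 ?ltW.
    have q2 : (32 * c%:R / r) * (eta * L%:R) = 8 * c%:R * L%:R^-1.
      by rewrite etaL; field; rewrite !gt_eqF.
    have q3 : eta * 1 <= eta * L%:R by rewrite ler_pM2l.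
    have -> : eta * (b * L)%:R = b%:R * (eta * L%:R) by rewrite natrM; ring.
    have q4 : 0 <= c%:R * L%:R^-1 :> R by rewrite mulr_ge0 ?ler0n ?ltW.
    by lra.
  rewrite -mulrBr normrM gtr0_norm // ler_pM2l // ler_norml => /andP[k1 k2].
  by split; rewrite -(ler_nat R) natrD; lra.
have relb (g : gT) p : (g p + b * L - rep (bx g) p < (2 * b * L).+1)%N.
  by have [h _] := rel g p; rewrite -mulnA; exact: shift_subn_lt.
pose j0 (g : gT) := (NU (rep (bx g))).2.
(* The excluded coordinate [j0 g] depends on the cube alone, so that two grid points with the same
   code omit the same coordinate. *)
pose code (g : gT) : {ffun 'I_k.+1 * bool -> 'I_(2 * c * L).+1} *
    {ffun 'I_k * bool -> 'I_(2 * b * L).+1} * {ffun bool -> 'I_d.+1} :=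
  (bx g, [ffun q => Ordinal (relb g (lift (j0 g) q.1, q.2))],
   [ffun s => inord (g (j0 g, s) %% d.+1)]).
suff codeI : injective code.
  have := leq_card code codeI; rewrite !card_prod !card_ffun !card_prod !card_ord !card_bool.
  by rewrite leqNgt; apply/negP; rewrite negbK ![(_ * 2)%N]mulnC; exact: hL0.
move=> g g' [ebx erel emod].
have ej : j0 g = j0 g' by rewrite /j0 ebx.
have eoff j s : j != j0 g -> g (j, s) = g' (j, s).
  rewrite eq_sym => /unlift_some[i ji _]; apply: val_inj.
  have := congr1 (fun f : {ffun _ -> _} => val (f (i, s))) erel.
  rewrite !ffunE /= -ej -ji ebx; have [_ q1] := rel g (j, s); have [_ q2] := rel g' (j, s).
  by rewrite ebx in q1; exact: shift_subn_inj.
have [nu1 nuj nuJ] := hNU (rep (bx g)).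
set h := rep (bx g) in nu1 nuj nuJ; set nu := (NU h).1 in nu1 nuj nuJ.
pose dot (u : 'rV[C]_k.+1) := \sum_j u 0 j * nu j.
have dotB u v : dot (u - v) = dot u - dot v.
  by rewrite /dot -sumrB; apply: eq_bigr => j _; rewrite entryB mulrBl.
have dotb u : nrm (dot u) <= k.+1%:R * nrm u.
  apply: le_trans (nrm_sum _ _ _) _.
  apply: (@le_trans _ _ (\sum_(j < k.+1) nrm u)); last by rewrite sumr_const card_ord mulr_natl.
  apply: ler_sum => j _; rewrite nrmM -[leRHS]mulr1.
  by apply: ler_pM; rewrite ?nrm_ge0 ?nrm_entry.
have small e : bx e = bx g -> nrm (dot (G (xs e) - G (xs h))) <= k.+1%:R * (4 * c%:R * L%:R^-1 ^+ 2).
  move=> ee; have [q _] := delta e; rewrite ee -/h in q.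
  have -> : dot (G (xs e) - G (xs h)) = dot (G (xs e) - G (xs h) - (xs e - xs h) *m J (xs h)).
    have nz : dot ((xs e - xs h) *m J (xs h)) = 0 by exact: nuJ.
    by rewrite [RHS]dotB nz subr0.
  by apply: le_trans (dotb _) _; rewrite ler_wpM2l ?ler0n.
(* All other coordinates already agree and [nu] is 1 at [j0 g]: the pairing reads off the missing
   coordinate. *)
have WE : dot (Y g - Y g') = (Y g - Y g') 0 (j0 g).
  rewrite /dot (bigD1 (j0 g)) //= nu1 mulr1 big1 ?addr0 // => j jj.
  have -> : (Y g - Y g') 0 j = 0; last by rewrite mul0r.
  by rewrite entryB /Y !mxE !(eoff _ _ jj) subrr.
have Wb : nrm ((Y g - Y g') 0 (j0 g)) <= eta * d%:R.
  rewrite -WE.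
  have -> : Y g - Y g' = ((G (xs g) - G (xs h)) - (G (xs g') - G (xs h))) -
      ((G (xs g) - Y g) - (G (xs g') - Y g')).
    by apply/rowP => j; rewrite !mxE; ring.
  rewrite dotB dotB; apply: le_trans (nrmD _ _) _; rewrite nrmN.
  have q1 := small g erefl; have q2 := small g' (esym ebx).
  have q3 := nrmD (dot (G (xs g) - G (xs h))) (- dot (G (xs g') - G (xs h))).
  have q4 := dotb (G (xs g) - Y g - (G (xs g') - Y g')).
  have q5 : nrm (G (xs g) - Y g - (G (xs g') - Y g')) <= eta.
    apply: le_trans (nrmD _ _) _; rewrite nrmN.
    by have := Gs g; have := Gs g'; lra.
  have q6 : k.+1%:R * nrm (G (xs g) - Y g - (G (xs g') - Y g')) <= k.+1%:R * eta.
    by rewrite ler_wpM2l ?ler0n.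
  have q7 : eta * (64 * k.+1%:R * c%:R / r + k.+1%:R) <= eta * d%:R.
    by rewrite ler_pM2l // ltW.
  have q8 : eta * (64 * k.+1%:R * c%:R / r + k.+1%:R) =
      2 * (k.+1%:R * (4 * c%:R * L%:R^-1 ^+ 2)) * 2 + k.+1%:R * eta.
    by rewrite /eta; field; rewrite !gt_eqF.
  have q9 : 0 <= k.+1%:R * (4 * c%:R * L%:R^-1 ^+ 2) :> R.
    by rewrite !mulr_ge0 ?ler0n ?exprn_ge0 ?ltW.
  by rewrite nrmN in q3; lra.
apply/ffunP => -[j s]; have [->|/eoff //] := eqVneq j (j0 g).
apply: val_inj.
have emod' : (g (j0 g, s) = g' (j0 g, s) %[mod d.+1])%N.
  have := congr1 (fun f : {ffun _ -> _} => val (f s)) emod.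
  by rewrite !ffunE -ej /= !inordK ?ltn_mod.
have : `|eta * (g (j0 g, s))%:R - eta * (g' (j0 g, s))%:R| <= eta * d%:R.
  have -> : eta * (g (j0 g, s))%:R - eta * (g' (j0 g, s))%:R = part s ((Y g - Y g') 0 (j0 g)).
    by rewrite entryB partB !Ypart /=; ring.
  by apply: le_trans Wb; exact: part_le.
rewrite -mulrBr normrM gtr0_norm // ler_pM2l // ler_norml => /andP[k1 k2].
by apply: (@eq_modn_close _ _ d) emod'; rewrite -(ler_nat R) natrD; lra.
Qed.

End Sard.

(** * Second-order bounds in several variables and a Sard theorem for equal dimensions *)

Section Taylor.
Local Open Scope complex_scope.
Variable R : realType.
Local Notation C := R[i].

Lemma mulmx_bounded n m (A : 'M[C]_(n, m)) :
  exists2 K : R, 0 <= K & forall v : 'rV_n, nrm (v *m A) <= K * nrm v.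
Proof.
exists (\sum_j \sum_i nrm (A i j)) => [|v].
  by apply: sumr_ge0 => j _; apply: sumr_ge0 => i _; exact: nrm_ge0.
have h0 j : 0 <= \sum_i nrm (A i j) by apply: sumr_ge0 => i _; exact: nrm_ge0.
apply: nrm_rV => [|j]; first by rewrite mulr_ge0 ?nrm_ge0 // sumr_ge0.
rewrite mxE; apply: le_trans (nrm_sum _ _ _) _.
apply: (@le_trans _ _ ((\sum_i nrm (A i j)) * nrm v)).
  rewrite mulr_suml; apply: ler_sum => i _; rewrite nrmM mulrC.
  by rewrite ler_wpM2l ?nrm_ge0 ?nrm_entry.
rewrite ler_wpM2r ?nrm_ge0 // (bigD1 j) //= lerDl.
by apply: sumr_ge0.
Qed.

Definition mdiff n m (F : 'rV[C]_n -> 'rV[C]_m) x (A : 'M[C]_(n, m)) :=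
  fdiff F x (fun u => u *m A).

Lemma mdiff_cont n m (F : 'rV[C]_n -> 'rV[C]_m) x A : mdiff F x A ->
  forall e : R, 0 < e -> exists2 d : R, 0 < d & forall u, nrm u < d -> nrm (F (x + u) - F x) < e.
Proof.
by move=> FA; have [K _ hK] := mulmx_bounded A; exact: fdiff_cont FA hK.
Qed.

Lemma mdiff_mulmx a b (x : 'rV[C]_a) (L : 'M[C]_(a, b)) : mdiff (mulmx^~ L) x L.
Proof.
move=> e e0; exists 1 => // u _.
have -> : (x + u) *m L - x *m L - u *m L = 0 by rewrite -!mulmxBl [x + u]addrC addrK subrr mul0mx.
by rewrite nrm0 mulr_ge0 ?nrm_ge0 // ltW.
Qed.

Lemma mdiff_taylor n m (F : 'rV[C]_n -> 'rV[C]_m) (J : 'rV[C]_n -> 'M[C]_(n, m))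
    (p : 'rV[C]_n) (r : R) : 0 < r -> (forall x, nrm (x - p) < r -> mdiff F x (J x)) ->
  exists K s : R, [/\ 0 <= K, 0 < s & forall x u, nrm (x - p) < s -> nrm u < s ->
    [/\ forall v : 'rV_n, nrm (v *m J x) <= K * nrm v,
        forall v : 'rV_n, nrm (v *m J (x + u) - v *m J x) <= K * nrm u * nrm v
      & nrm (F (x + u) - F x - u *m J x) <= K * nrm u ^+ 2]].
Proof.
move=> r0 FJ.
have Fp : mdiff F p (J p) by apply: FJ; rewrite subrr nrm0.
have [d d0 hd] := mdiff_cont Fp ltr01.
(* Continuity at [p] supplies the bound on [F] that Cauchy's estimate requires, on a smaller
   ball. *)
pose r1 := Num.min r d.
have r10 : 0 < r1 by rewrite lt_min r0.
have Fb x : nrm (x - p) < r1 -> mdiff F x (J x) /\ nrm (F x) <= nrm (F p) + 1.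
  rewrite lt_min => /andP[/FJ h1 /hd]; rewrite [p + _]addrC subrK => h2; split=> //.
  by rewrite -[F x](subrK (F p)); have := nrmD (F x - F p) (F p); lra.
have coord (j : 'I_m) : exists K : R, 0 <= K /\ forall x u, nrm (x - p) < r1 / 16 -> nrm u < r1 / 16 ->
    [/\ forall v : 'rV_n, nrm ((v *m J x) 0 j) <= K * nrm v,
        forall v : 'rV_n, nrm ((v *m J (x + u)) 0 j - (v *m J x) 0 j) <= K * nrm u * nrm v
      & nrm (F (x + u) 0 j - F x 0 j - (u *m J x) 0 j) <= K * nrm u ^+ 2].
  have [|||K K0 hK] := @holomorphic_taylor _ _ (fun x => F x 0 j)
      (fun x (v : 'rV_n) => (v *m J x) 0 j) p r1 (nrm (F p) + 1) r10.
  - by move=> x a u; rewrite -scalemxAl mxE.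
  - by move=> x u v; rewrite mulmxDl mxE.
  - move=> x /Fb[h1 h2]; split; last by apply: le_trans (nrm_entry _ _) h2.
    move=> e e0; have [d1 d10 hd1] := h1 e e0; exists d1 => // u /hd1.
    by apply: le_trans; rewrite -!entryB; exact: nrm_entry.
  by exists K.
have [K hK] := choice coord.
have K0 j : 0 <= K j by have [] := hK j.
have KS j : K j <= \sum_i K i by rewrite (bigD1 j) //= lerDl sumr_ge0.
have S0 : 0 <= \sum_i K i by apply: sumr_ge0.
exists (\sum_j K j), (r1 / 16); split => //; first lra.
move=> x u hx hu; split.
- move=> v; apply: nrm_rV => [|j]; first by rewrite mulr_ge0 ?nrm_ge0.
  have [_ /(_ x u hx hu)[h _ _]] := hK j; apply: le_trans (h v) _.
  by rewrite ler_wpM2r ?nrm_ge0.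
- move=> v; apply: nrm_rV => [|j]; first by rewrite !mulr_ge0 ?nrm_ge0.
  have [_ /(_ x u hx hu)[_ h _]] := hK j; rewrite entryB; apply: le_trans (h v) _.
  by do 2 rewrite ler_wpM2r ?nrm_ge0 //.
- apply: nrm_rV => [|j]; first by rewrite mulr_ge0 ?exprn_ge0 ?nrm_ge0.
  have [_ /(_ x u hx hu)[_ _ h]] := hK j; rewrite !entryB; apply: le_trans h _.
  by rewrite ler_wpM2r ?exprn_ge0 ?nrm_ge0.
Qed.

(* Om is a countable union of sets to which [nowhere_dense_image] applies, and
   a nested sequence of balls avoids all their images. *)
Theorem singular_image_misses k (Om : set 'rV[C]_k) (G : 'rV[C]_k -> 'rV[C]_k)
    (J : 'rV[C]_k -> 'M[C]_k) : (0 < k)%N ->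
  (forall x, Om x -> exists2 d : R, 0 < d & forall y, nrm (y - x) < d -> Om y) ->
  (forall x, Om x -> mdiff G x (J x)) -> (forall x, Om x -> \det (J x) = 0) ->
  forall (y0 : 'rV[C]_k) (r : R), 0 < r ->
  exists2 y, nrm (y - y0) <= r & forall x, Om x -> G x <> y.
Proof.
case: k Om G J => // k Om G J _ Oopen GJ Jdet y0 r r0.
(* One integer bounds the point, the differential, the Taylor constant and the inverse radius of
   validity; this makes the cover countable. *)
pose X (c : nat) := [set x | [/\ Om x, nrm x <= c.+1%:R,
  forall v : 'rV_k.+1, nrm (v *m J x) <= c.+1%:R * nrm v
  & forall y, nrm (y - x) * c.+1%:R < 1 ->
     nrm (G y - G x - (y - x) *m J x) <= c.+1%:R * nrm (y - x) ^+ 2]].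
have cover x : Om x -> exists c, X c x.
  move=> Ox; have [d d0 hd] := Oopen x Ox.
  have [|K [s [K0 s0 hK]]] := @mdiff_taylor _ _ G J x d d0; first by move=> y /hd /GJ.
  pose c := Num.truncn (nrm x + K + s^-1); exists c.
  have hc : nrm x + K + s^-1 < c.+1%:R by exact: truncnS_gt.
  have si : 0 < s^-1 by rewrite invr_gt0.
  have X0 := nrm_ge0 x; have xx : nrm (x - x) < s by rewrite subrr nrm0.
  split => //; first lra.
    move=> v; have [|h _ _] := hK x 0 xx; first by rewrite nrm0.
    by apply: le_trans (h v) _; rewrite ler_wpM2r ?nrm_ge0 //; lra.
  move=> y hy; have ys : nrm (y - x) < s.
    rewrite -[s]invrK -[_^-1^-1]mul1r ltr_pdivlMr //; apply: le_lt_trans hy.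
    by rewrite ler_wpM2l ?nrm_ge0 //; lra.
  have [_ _] := hK x (y - x) xx ys; rewrite [x + _]addrC subrK => h; apply: le_trans h _.
  by rewrite ler_wpM2r ?exprn_ge0 ?nrm_ge0 //; lra.
have step (nq : nat * ('rV[C]_k.+1 * R)) : exists q : 'rV[C]_k.+1 * R, 0 < nq.2.2 ->
    [/\ 0 < q.2, q.2 <= nq.2.2 / 4, nrm (q.1 - nq.2.1) <= nq.2.2 / 2
      & forall x, X nq.1 x -> 2 * q.2 < nrm (G x - q.1)].
  case: nq => n [y s] /=; have [s0|s0] := ltP 0 s; last by exists (y, s); rewrite ltNge s0.
  have [|||||y1 [r1 [h1 h2 h3 h4]]] := @nowhere_dense_image _ k (X n) G J n.+1 _ _ _ _ _ y s s0.
  - by [].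
  - by move=> x [].
  - by move=> x [].
  - by move=> x z [_ _ _ h] _; exact: h.
  - by move=> x [/Jdet].
  (* The radius is halved because the real coordinates of the limit are caught separately, which
     places the limit only within twice the radius of each centre. *)
  exists (y1, r1 / 2) => _ /=; split => //; try lra.
  by move=> x /h4; lra.
have [f hf] := choice step.
pose fix q n : 'rV[C]_k.+1 * R := if n is n'.+1 then f (n', q n') else (y0, r / 2).
have q0 n : 0 < (q n).2.
  by elim: n => [|n ih] /=; [lra|have [] := hf (n, q n) ih].
have qS n : [/\ (q n.+1).2 <= (q n).2 / 4, nrm ((q n.+1).1 - (q n).1) <= (q n).2 / 2
      & forall x, X n x -> 2 * (q n.+1).2 < nrm (G x - (q n.+1).1)].
  by have [] := hf (n, q n) (q0 n).
have lim (p : 'I_k.+1 * bool) : exists z : R, forall n,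
    part p.2 ((q n).1 0 p.1) - (q n).2 <= z <= part p.2 ((q n).1 0 p.1) + (q n).2.
  have dist n : `|part p.2 ((q n.+1).1 0 p.1) - part p.2 ((q n).1 0 p.1)| <= (q n).2 / 2.
    have [_ h _] := qS n; apply: le_trans h; rewrite -partB -entryB; exact: part_entry.
  apply: nested_intervals => n; have [h1 _ _] := qS n; have := dist n; have := q0 n;
    rewrite ?ler_norml; lra.
have [z hz] := choice lim.
pose y : 'rV[C]_k.+1 := \row_j (z (j, false) +i* z (j, true)).
have yq n : nrm (y - (q n).1) <= 2 * (q n).2.
  apply: nrm_parts => [|j s]; first exact: ltW.
  rewrite entryB partB; have -> : part s (y 0 j) = z (j, s) by rewrite mxE; case: s.
  by have := hz (j, s) n; rewrite /= ler_norml; lra.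
exists y; first by have := yq 0%N; rewrite /=; lra.
move=> x /cover[c Xx] Gx; have [_ _ /(_ x Xx)] := qS c.
by rewrite Gx; have := yq c.+1; lra.
Qed.

End Taylor.

(** * The complex exponential *)

Section Exponential.
Local Open Scope complex_scope.
Variable R : realType.
Local Notation C := R[i].

Lemma expCD (z w : C) : expC (z + w) = expC z * expC w.
Proof.
case: z w => [a b] [c d]; rewrite /expC /= expRD cosD sinD.
by apply/eqP; rewrite eq_complex /=; apply/andP; split; apply/eqP; ring.
Qed.

Lemma expC0 : expC (0 : C) = 1.
Proof. by rewrite /expC /= expR0 cos0 sin0 mul1r. Qed.

Lemma expCNK (z : C) : expC z * expC (- z) = 1.
Proof. by rewrite -expCD subrr expC0. Qed.

Lemma expC_neq0 (z : C) : expC z != 0.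
Proof.
by apply/eqP => h; have := expCNK z; rewrite h mul0r => /eqP; rewrite eq_sym oner_eq0.
Qed.

Lemma is_derive_eps (f : R -> R) (x l : R) : is_derive x 1 f l ->
  forall e : R, 0 < e -> exists2 d : R, 0 < d &
    forall u : R, `|u| < d -> `|f (x + u) - f x - l * u| <= e * `|u|.
Proof.
move=> [df fl] e e0.
have : (fun t : R => t^-1 *: ((f \o shift x) (t *: 1) - f x)) @ 0^' --> l.
  by rewrite -fl; exact: df.
move=> /cvgrPdist_le/(_ e e0); rewrite near_withinE => /nbhs_normP[d d0 hd].
exists d => // u ud; have [->|u0] := eqVneq u 0.
  by rewrite addr0 subrr mulr0 subrr normr0 mulr0.
have := hd u; rewrite /ball_ /= sub0r normrN => /(_ ud u0).
rewrite -[u *: 1]/(u * 1) mulr1 -[_ *: _]/(u^-1 * _) [u + x]addrC => h.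
have -> : f (x + u) - f x - l * u = - ((l - u^-1 * (f (x + u) - f x)) * u) by field.
by rewrite normrN normrM ler_wpM2r.
Qed.

(** The real derivatives of [expR], [cos] and [sin] at 0 are combined on real and imaginary parts;
    other points then follow from the addition formula. *)
Lemma cdiff_expC0 : cdiff (@expC R) 0 1.
Proof.
move=> e e0.
(* The bound by 1 gives |exp a - 1| <= 2 |a|, which makes the mixed products second-order. *)
have e8 : 0 < Num.min (e / 8) 1 by rewrite lt_min ltr01 andbT; lra.
have [d1 d10 h1] := is_derive_eps (is_derive_expR (0 : R)) e8.
have [d2 d20 h2] := is_derive_eps (is_derive_cos (0 : R)) e8.
have [d3 d30 h3] := is_derive_eps (is_derive_sin (0 : R)) e8.
pose d := Num.min (Num.min d1 d2) (Num.min d3 (Num.min (e / 8) (1 / 2))).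
exists d; first by rewrite /d !lt_min d10 d20 d30 /=; apply/andP; split; lra.
case=> a b ud.
have A : `|a| <= nrm (a +i* b) := ler_Re_nrm (a +i* b).
have B : `|b| <= nrm (a +i* b) := ler_Im_nrm (a +i* b).
have A0 := normr_ge0 a; have B0 := normr_ge0 b.
move: ud; rewrite /d !lt_min => /andP[/andP[u1 u2] /andP[u3 /andP[u4 u5]]].
have k1 := h1 a (le_lt_trans A u1); have k2 := h2 b (le_lt_trans B u2).
have k3 := h3 b (le_lt_trans B u3); move: k1 k2 k3.
rewrite !add0r expR0 cos0 sin0 oppr0 mul0r addr0 !subr0 !mul1r => k1 k2 k3.
have m1 : Num.min (e / 8) 1 <= e / 8 by rewrite ge_min lexx.
have m2 : Num.min (e / 8) 1 <= 1 by rewrite ge_min lexx orbT.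
have kk (x y : R) : `|x| <= Num.min (e / 8) 1 * `|y| -> `|x| <= e / 8 * `|y| /\ `|x| <= `|y|.
  move=> h; split; apply: le_trans h _; first by rewrite ler_wpM2r.
  by rewrite -[leRHS]mul1r ler_wpM2r.
have [a1 a2] := kk _ _ k1; have [b1 b2] := kk _ _ k2; have [c1 _] := kk _ _ k3.
have [E EE] : exists E, E = expR a by exists (expR a).
rewrite -EE in a1 a2.
have E1 : `|E - 1| <= 2 * `|a|.
  have -> : E - 1 = (E - 1 - a) + a by ring.
  by apply: le_trans (ler_normD _ _) _; lra.
have E2 : `|E| <= 2.
  have -> : E = (E - 1) + 1 by ring.
  by apply: le_trans (ler_normD _ _) _; rewrite normr1; lra.
have n0 : 0 <= e * nrm (a +i* b) by rewrite mulr_ge0 ?nrm_ge0 // ltW.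
have r1 : `|E * cos b - 1 - a| <= e / 2 * nrm (a +i* b).
  have -> : E * cos b - 1 - a = (E - 1 - a) + E * (cos b - 1) by ring.
  apply: le_trans (ler_normD _ _) _; rewrite normrM.
  have : `|E| * `|cos b - 1| <= 2 * (e / 8 * `|b|) by apply: ler_pM.
  have : e / 8 * `|a| <= e / 8 * nrm (a +i* b) by rewrite ler_wpM2l //; lra.
  have : e / 8 * `|b| <= e / 8 * nrm (a +i* b) by rewrite ler_wpM2l //; lra.
  by lra.
have r2 : `|E * sin b - b| <= e / 2 * nrm (a +i* b).
  have -> : E * sin b - b = E * (sin b - b) + (E - 1) * b by ring.
  apply: le_trans (ler_normD _ _) _; rewrite !normrM.
  have : `|E| * `|sin b - b| <= 2 * (e / 8 * `|b|) by apply: ler_pM.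
  have : `|E - 1| * `|b| <= (2 * (e / 8)) * `|b| by rewrite ler_wpM2r //; lra.
  have : e / 8 * `|b| <= e / 8 * nrm (a +i* b) by rewrite ler_wpM2l //; lra.
  by lra.
rewrite expC0 /expC /= -EE; apply: le_trans (nrm_le_ReIm _) _.
have -> : complex.Re (E%:C * (cos b +i* sin b) - 1 - (a +i* b)) = E * cos b - 1 - a.
  by rewrite !raddfB /=; ring.
have -> : complex.Im (E%:C * (cos b +i* sin b) - 1 - (a +i* b)) = E * sin b - b.
  by rewrite !raddfB /=; ring.
lra.
Qed.

Lemma cdiff_expC (z : C) : cdiff (@expC R) z (expC z).
Proof.
move=> e e0; have z1 : 0 < nrm (expC z) + 1 by have := nrm_ge0 (expC z); lra.
have [d d0 hd] := cdiff_expC0 (divr_gt0 e0 z1); exists d => // u /hd.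
rewrite add0r expC0 mul1r expCD => h.
have -> : expC z * expC u - expC z - expC z * u = expC z * (expC u - 1 - u) by ring.
rewrite nrmM; apply: le_trans (ler_wpM2l (nrm_ge0 _) h) _.
rewrite mulrA ler_wpM2r ?nrm_ge0 // mulrA ler_pdivrMr // [leLHS]mulrC ler_pM2l //; lra.
Qed.

Section Directional.
Variable V : normedModType C.
Implicit Types (f : V -> C).

Lemma derive_cdiff f (a v : V) (d : C) : cdiff (fun s => f (a + s *: v)) 0 d ->
  'D_v f a = d.
Proof.
move=> h; apply/cvg_lim => //; apply/cvgrPdist_le => e e0.
have e0' : 0 < complex.Re e by move: e0; rewrite ltcE => /andP[].
have eE : e = (complex.Re e)%:C by rewrite RRe_real // gtr0_real.
have [r r0 hr] := h _ e0'.
near=> t; have t0 : t != 0 by near: t; exact: nbhs_dnbhs_neq.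
have tr : nrm t < r.
  have : `|t| < r%:C by near: t; apply: dnbhs0_lt; rewrite ltcR.
  by rewrite nrmE ltcR.
have := hr _ tr; rewrite add0r scale0r addr0 [a + _]addrC => k.
rewrite eE nrmE lecR /=.
have -> : d - t^-1 *: (f (t *: v + a) - f a) =
    - (t^-1 * (f (t *: v + a) - f a - d * t)).
  by rewrite -[t^-1 *: _]/(t^-1 * _); field.
by rewrite nrmN nrmM nrmV mulrC ler_pdivrMr ?nrm_gt0.
Unshelve. all: by end_near. Qed.

End Directional.

Lemma fdiff_sum (V : normedModType C) (I : Type) (r : seq I) (h : I -> V -> C) (z : V)
    (d : I -> V -> C) : (forall i, fdiff (h i) z (d i)) ->
  fdiff (fun w => \sum_(i <- r) h i w) z (fun u => \sum_(i <- r) d i u).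
Proof.
move=> hd; elim: r => [|i r ih] e e0.
  by exists 1 => // u _; rewrite !big_nil !subr0 nrm0 mulr_ge0 ?nrm_ge0 // ltW.
have e2 : 0 < e / 2 by lra.
have [d1 d10 h1] := ih _ e2; have [d2 d20 h2] := hd i _ e2.
exists (Num.min d1 d2); first by rewrite lt_min d10.
move=> u; rewrite lt_min => /andP[/h1 k1 /h2 k2]; rewrite !big_cons.
have -> : h i (z + u) + \sum_(j <- r) h j (z + u) - (h i z + \sum_(j <- r) h j z) -
    (d i u + \sum_(j <- r) d j u) = (h i (z + u) - h i z - d i u) +
    (\sum_(j <- r) h j (z + u) - \sum_(j <- r) h j z - \sum_(j <- r) d j u) by ring.
by apply: le_trans (nrmD _ _) _; lra.
Qed.

End Exponential.

(** * The Cauchy-Binet formula *)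

Section CauchyBinet.
Variables (K : comNzRingType) (n N : nat).
Implicit Types (A : 'M[K]_(n, N)) (B : 'M[K]_(N, n)).

(** Distributing the product over rows selects an index [f i] in each row; the sum over permutations
    then regroups into a determinant of selected rows of [B]. *)
Lemma det_mulmx_ffun A B :
  \det (A *m B) = \sum_(f : {ffun 'I_n -> 'I_N}) (\prod_i A i (f i)) * \det (rowsub f B).
Proof.
rewrite /determinant.
under eq_bigr => s _.
  under eq_bigr => i _ do rewrite mxE.
  rewrite bigA_distr_bigA /= mulr_sumr.
  over.
rewrite exchange_big /=; apply: eq_bigr => f _; rewrite mulr_sumr.
apply: eq_bigr => s _; rewrite big_split /= mulrCA; congr (_ * (_ * _)).
by apply: eq_bigr => i _; rewrite mxE.
Qed.

Lemma det_rowsub_noninj B (f : {ffun 'I_n -> 'I_N}) : ~~ injectiveb f ->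
  \det (rowsub f B) = 0.
Proof.
move=> /injectivePn[i [j ij fij]]; apply: (determinant_alternate ij) => k.
by rewrite !mxE fij.
Qed.

Definition enum_sub (s : {set 'I_N}) (e : #|s| = n) : 'I_n -> 'I_N :=
  fun i => enum_val (cast_ord (esym e) i).

Lemma enum_sub_inj s e : injective (@enum_sub s e).
Proof. by move=> i j /enum_val_inj /cast_ord_inj. Qed.

(** The injections with image [s] are the increasing enumeration of [s] composed with permutations.
    The sign from reordering the rows of [B] rebuilds the minor of [A]. *)
Lemma sum_image A B (s : {set 'I_N}) (e : #|s| = n) :
  \sum_(f : {ffun 'I_n -> 'I_N} | injectiveb f && (f @: 'I_n == s))
     (\prod_i A i (f i)) * \det (rowsub f B) =
  \det (colsub (enum_sub e) A) * \det (rowsub (enum_sub e) B).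
Proof.
pose h (p : 'S_n) : {ffun 'I_n -> 'I_N} := [ffun i => enum_sub e (p i)].
have hs p : injectiveb (h p) && (h p @: 'I_n == s).
  apply/andP; split.
    by apply/injectiveP => i j; rewrite !ffunE => /enum_sub_inj /perm_inj.
  rewrite eqEcard; apply/andP; split.
    by apply/fintype.subsetP => _ /imsetP[i _ ->]; rewrite ffunE; exact: enum_valP.
  rewrite card_imset ?card_ord ?e // => i j.
  by rewrite !ffunE => /enum_sub_inj /perm_inj.
have surj (f : {ffun 'I_n -> 'I_N}) : injectiveb f && (f @: 'I_n == s) ->
    exists p, h p = f.
  move=> /andP[/injectiveP fi /eqP fs].
  have fin i : f i \in s by rewrite -fs; apply/imsetP; exists i.
  pose q i := cast_ord e (enum_rank_in (fin i) (f i)).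
  have qE i : enum_sub e (q i) = f i.
    by rewrite /enum_sub /q cast_ordK enum_rankK_in.
  have qi : injective q by move=> i j /(congr1 (enum_sub e)); rewrite !qE => /fi.
  by exists (perm qi); apply/ffunP => i; rewrite ffunE permE qE.
pose F (f : {ffun 'I_n -> 'I_N}) := (\prod_i A i (f i)) * \det (rowsub f B).
have hinj : injective h.
  move=> p q /ffunP pq; apply/permP => i; apply: (@enum_sub_inj _ e).
  by have := pq i; rewrite !ffunE.
transitivity (\sum_p F (h p)).
  (* [pick] serves as the partial inverse of [h]. *)
  rewrite (reindex_omap h (fun f => [pick p | h p == f])) /=; last first.
    move=> f /surj[p hp]; by case: pickP => [q /eqP <- //|/(_ p)]; rewrite hp eqxx.
  apply: eq_bigl => p; rewrite hs /=; by case: pickP => [q /eqP /hinj ->|/(_ p)]; rewrite eqxx.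
rewrite /F [X in X * _]/determinant mulr_suml; apply: eq_bigr => p _.
have -> : rowsub (h p) B = row_perm p (rowsub (enum_sub e) B).
  by apply/matrixP => i j; rewrite !mxE ffunE.
rewrite row_permE det_mulmx det_perm mulrA; congr (_ * _).
by rewrite mulrC; congr (_ * _); apply: eq_bigr => i _; rewrite mxE ffunE.
Qed.

(** The minors are given by functions on all subsets, so that the sum contains no proof of
    [#|s| = n]. *)
Theorem cauchy_binet A B (mA mB : {set 'I_N} -> K) :
  (forall (s : {set 'I_N}) (e : #|s| = n), mA s = \det (colsub (enum_sub e) A)) ->
  (forall (s : {set 'I_N}) (e : #|s| = n), mB s = \det (rowsub (enum_sub e) B)) ->
  \det (A *m B) = \sum_(s : {set 'I_N} | #|s| == n) mA s * mB s.
Proof.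
move=> hA hB; rewrite det_mulmx_ffun (bigID (fun f : {ffun 'I_n -> 'I_N} => injectiveb f)) /=.
rewrite [X in _ + X]big1 ?addr0; last by move=> f /det_rowsub_noninj ->; rewrite mulr0.
rewrite (partition_big (fun f : {ffun 'I_n -> 'I_N} => f @: 'I_n) (fun s => #|s| == n)) /=.
  by apply: eq_bigr => s /eqP e; rewrite sum_image hA hB.
by move=> f /injectiveP fi; rewrite card_imset // card_ord.
Qed.

End CauchyBinet.

Lemma conform_castmx_id (K : Type) n p (e : p = n) (M : 'M[K]_(n, p)) (M0 : 'M[K]_n) :
  conform_mx M0 M = castmx (erefl, e) M.
Proof. by case: n / e M M0 => M M0; rewrite conform_mx_id castmx_id. Qed.

(** * Weighted Gram determinants *)

Section WeightedGram.
Variables (R : realType) (n N : nat).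
Local Open Scope complex_scope.
Variable A : 'M[R]_(1 + n, N).

Definition AhatC : 'M[R[i]]_(n, N) := map_mx (real_complex R) (Ahat A).

Lemma maximal_minorE (s : {set 'I_N}) (e : #|s| = n) :
  maximal_minor A s = \det (colsub (enum_sub e) (Ahat A)).
Proof.
rewrite /maximal_minor (conform_castmx_id e); congr (\det _).
by apply/matrixP => i j; rewrite castmxE !mxE cast_ord_id.
Qed.

Lemma prod_enum_sub (s : {set 'I_N}) (e : #|s| = n) (d : 'I_N -> R[i]) :
  \prod_i d (enum_sub e i) = \prod_(k in s) d k.
Proof.
rewrite [RHS]big_enum_val (reindex (cast_ord (esym e))) //.
by exists (cast_ord e) => i _; rewrite ?cast_ordK ?cast_ordKV.
Qed.

Lemma det_weighted_gram (d : 'rV[R[i]]_N) :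
  \det (AhatC *m diag_mx d *m AhatC^T) = \sum_(s : {set 'I_N} | #|s| == n)
    (maximal_minor A s ^+ 2)%:C * \prod_(k in s) d 0 k.
Proof.
rewrite -mulmxA (@cauchy_binet _ _ _ AhatC (diag_mx d *m AhatC^T) (fun s => (maximal_minor A s)%:C)
   (fun s => (maximal_minor A s)%:C * \prod_(k in s) d 0 k)).
- by apply: eq_bigr => s _; rewrite mulrA rmorphXn.
- move=> s e; rewrite maximal_minorE -det_map_mx; congr (\det _).
  by apply/matrixP => i j; rewrite !mxE.
(* The diagonal matrix multiplies the selected rows by entries of [d], and their product comes out
   of the minor. *)
- move=> s e; rewrite maximal_minorE -(prod_enum_sub e) mulrC -[(\det _)%:C]det_map_mx -det_tr.
  have -> : rowsub (enum_sub e) (diag_mx d *m AhatC^T) =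
      diag_mx (\row_i d 0 (enum_sub e i)) *m (map_mx (real_complex R) (colsub (enum_sub e) (Ahat A)))^T.
    by apply/matrixP => i j; rewrite !mul_diag_mx !mxE.
  by rewrite det_mulmx det_diag; congr (_ * _); apply: eq_bigr => i _; rewrite mxE.
Qed.

End WeightedGram.

(** * The Horn-Kapranov parametrization *)

Section Hessian.
Variables (R : realType) (n N m : nat).
Local Open Scope complex_scope.
Local Notation C := R[i].
Variables (A : 'M[R]_(1 + n, N)) (B : 'M[R]_(N, m)).

Definition galeC : 'M[C]_(N, m) := map_mx (real_complex R) B.

Lemma gale_formE k (t : 'rV[C]_m) : gale_form B k t = (t *m galeC^T) 0 k.
Proof. by rewrite mxE; apply: eq_bigr => i _; rewrite !mxE mulrC. Qed.

Lemma alpha_formE k (w : 'rV[C]_n) : alpha_form A k w = (w *m (AhatC A)) 0 k.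
Proof. by rewrite mxE; apply: eq_bigr => i _; rewrite !mxE. Qed.

Lemma alpha_formN k (w : 'rV[C]_n) : alpha_form A k (- w) = - alpha_form A k w.
Proof. by rewrite !alpha_formE mulNmx mxE. Qed.

Lemma cdiff_expC_line (c b a : C) : cdiff (fun s => c * expC (b + s * a)) 0 (c * expC b * a).
Proof.
have h0 : fdiff (@expC R) (b + 0 * a) (fun u => expC b * u).
  by rewrite mul0r addr0; exact: cdiff_expC.
have h := @fdiff_line _ _ (@expC R) (fun u => expC b * u) b a 0 _ h0.
have hc : cdiff (fun=> c) 0 0.
  by move=> e e0; exists 1 => // u _; rewrite mul0r subr0 subrr nrm0 mulr_ge0 ?nrm_ge0 // ltW.
have := cdiffM hc (h _); rewrite mul0r add0r mulrA; apply.
by move=> x u; rewrite -[x *: u]/(x * u) mulrCA.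
Qed.

Lemma cdiff_expsum_line (c : 'rV[C]_N) (b a : 'I_N -> C) :
  cdiff (fun s => \sum_k c 0 k * expC (b k + s * a k)) 0 (\sum_k c 0 k * expC (b k) * a k).
Proof.
rewrite /cdiff; have -> : (fun u : C => (\sum_k c 0 k * expC (b k) * a k) * u) =
  (fun u => \sum_k (c 0 k * expC (b k) * a k) * u).
  by apply/funext => u; rewrite mulr_suml.
by apply: fdiff_sum => k; exact: cdiff_expC_line.
Qed.

Lemma expsum_derive (c : 'rV[C]_N) w0 w j : 'D_(delta_mx 0 j) (expsum A c w0) w =
  \sum_k c 0 k * expC (w0 + alpha_form A k w) * (AhatC A) j k.
Proof.
apply: derive_cdiff.
have -> : (fun s : C => expsum A c w0 (w + s *: delta_mx 0 j)) =
    fun s => \sum_k c 0 k * expC (w0 + alpha_form A k w + s * (AhatC A) j k).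
  apply/funext => s; apply: eq_bigr => k _; congr (_ * expC _).
  by rewrite -addrA !alpha_formE mulmxDl -scalemxAl -rowE !mxE.
exact: cdiff_expsum_line.
Qed.

Lemma expsum_derive0 (c : 'rV[C]_N) w0 w : 'D_1 (fun s : C => expsum A c s w) w0 =
  expsum A c w0 w.
Proof.
apply: derive_cdiff.
have -> : (fun s : C => expsum A c (w0 + s *: 1) w) =
    fun s => \sum_k c 0 k * expC (w0 + alpha_form A k w + s * 1).
  by apply/funext => s; apply: eq_bigr => k _; congr (_ * expC _); rewrite addrAC.
have := @cdiff_expsum_line c (fun k => w0 + alpha_form A k w) (fun=> 1).
by under eq_bigr do rewrite mulr1.
Qed.

Lemma hessianE (c : 'rV[C]_N) w : hessian A c w =
  (AhatC A) *m diag_mx (\row_k (c 0 k * expC (- 1 + alpha_form A k w))) *m (AhatC A)^T.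
Proof.
apply/matrixP => i j; rewrite mxE.
(* A first partial derivative is again an exponential sum, with coefficients multiplied by entries
   of [AhatC]; the same formula yields the second derivative. *)
have -> : (fun v : 'rV[C]_n => 'D_(delta_mx 0 j) (expsum A c (- 1)) v) =
    expsum A (\row_k (c 0 k * (AhatC A) j k)) (- 1).
  apply/funext => v; rewrite expsum_derive; apply: eq_bigr => k _.
  by rewrite [in RHS]mxE mulrAC.
rewrite expsum_derive mul_mx_diag mxE; apply: eq_bigr => k _.
by rewrite !mxE; ring.
Qed.

End Hessian.

(** * Uniqueness, composition and coordinates of differentials *)

Section Differentials.
Variables (R : realType).
Local Open Scope complex_scope.
Local Notation C := R[i].

Lemma finite_min (I : finType) (a : I -> R) : (forall i, 0 < a i) ->
  exists2 e : R, 0 < e & forall i, e <= a i.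
Proof.
move=> a0; have S0 : 0 <= \sum_i (a i)^-1 by apply: sumr_ge0 => i _; rewrite invr_ge0 ltW.
have S1 : 0 < 1 + \sum_i (a i)^-1 by lra.
(* This lies below every [a i] and is positive even if [I] is empty. *)
exists (1 + \sum_i (a i)^-1)^-1; first by rewrite invr_gt0.
move=> i; rewrite -[leRHS]invrK lef_pV2 ?posrE ?invr_gt0 //.
rewrite (bigD1 i) //=.
have : 0 <= \sum_(j | j != i) (a j)^-1 by apply: sumr_ge0 => j _; rewrite invr_ge0 ltW.
by lra.
Qed.

(** Both maps approximate the same increment, so that T - S is o(u); by homogeneity a fixed [u] can
    be scaled into any small ball. *)
Lemma fdiff_eq_near (V W : normedModType C) (f g : V -> W) x (T S : V -> W) (r : R) :
  0 < r -> (forall u, nrm u < r -> f (x + u) = g (x + u)) ->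
  fdiff f x T -> fdiff g x S ->
  (forall a u, T (a *: u) = a *: T u) -> (forall a u, S (a *: u) = a *: S u) ->
  forall u, T u = S u.
Proof.
move=> r0 fg fT gS TZ SZ u; apply/eqP; rewrite -subr_eq0; apply/eqP/nrm0_eq0.
apply/le_anti; rewrite nrm_ge0 andbT; apply/ler_addgt0Pr => e e0; rewrite add0r.
have U0 := nrm_ge0 u; have U1 : 0 < 2 * (nrm u + 1) by lra.
have [d1 d10 h1] := fT _ (divr_gt0 e0 U1); have [d2 d20 h2] := gS _ (divr_gt0 e0 U1).
pose d := Num.min r (Num.min d1 d2).
have d0 : 0 < d by rewrite !lt_min r0 d10.
pose s := d / (nrm u + 1); have s0 : 0 < s by rewrite divr_gt0 //; lra.
have su : nrm (s%:C *: u) < d.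
  rewrite nrmZ nrm_real gtr0_norm // /s mulrAC ltr_pdivrMr; last lra.
  by rewrite ltr_pM2l //; lra.
have := su; rewrite {1}/d !lt_min => /andP[/fg E /andP[/h1 k1 /h2 k2]].
have f0 : f x = g x by have := fg 0; rewrite addr0; apply; rewrite nrm0.
have : nrm (T (s%:C *: u) - S (s%:C *: u)) <= e / (2 * (nrm u + 1)) * nrm (s%:C *: u) * 2.
  have -> : T (s%:C *: u) - S (s%:C *: u) = (g (x + s%:C *: u) - g x - S (s%:C *: u)) -
      (f (x + s%:C *: u) - f x - T (s%:C *: u)).
    by rewrite E f0 opprB addrCA [_ - S _ - _]addrAC subrr sub0r addrC.
  by apply: le_trans (nrmD _ _) _; rewrite nrmN; lra.
rewrite TZ SZ -scalerBr !nrmZ nrm_real gtr0_norm // => h.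
rewrite -(ler_pM2l s0); apply: le_trans h _.
have -> : e / (2 * (nrm u + 1)) * (s * nrm u) * 2 = s * (e * nrm u / (nrm u + 1)).
  by field; lra.
rewrite ler_pM2l // ler_pdivrMr; last lra.
by rewrite ler_pM2l //; lra.
Qed.

Lemma cdiffB (h g : C -> C) z a b : cdiff h z a -> cdiff g z b ->
  cdiff (fun w => h w - g w) z (a - b).
Proof.
move=> ha gb; have := fdiffB ha gb; rewrite /cdiff.
by congr fdiff; apply/funext => u; rewrite mulrBl.
Qed.

Lemma cdiff_zero_near (h : C -> C) (a : C) (r : R) : 0 < r ->
  (forall c, nrm c < r -> h c = 0) -> cdiff h 0 a -> a = 0.
Proof.
move=> r0 h0 ha; rewrite -[a]mulr1.
refine (@fdiff_eq_near _ _ h (fun=> 0) 0 (fun u => a * u) (fun=> 0) r r0 _ ha _ _ _ 1).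
- by move=> u ur; rewrite add0r h0.
- by move=> e e0; exists 1 => // u _; rewrite !subr0 nrm0 mulr_ge0 ?nrm_ge0 // ltW.
- by move=> b u; rewrite -[b *: u]/(b * u) mulrCA.
- by move=> b u; rewrite scaler0.
Qed.

Lemma mdiff_comp a b c (F : 'rV[C]_a -> 'rV[C]_b) (G : 'rV[C]_b -> 'rV[C]_c) x J L :
  mdiff F x J -> mdiff G (F x) L -> mdiff (G \o F) x (J *m L).
Proof.
move=> FJ GL; have [K1 _ h1] := mulmx_bounded J; have [K2 _ h2] := mulmx_bounded L.
have := fdiff_comp FJ GL h1 h2 (fun u v => mulmxBl u v L).
by rewrite /mdiff; congr fdiff; apply/funext => u /=; rewrite mulmxA.
Qed.

Lemma differentiable_mdiff a b (F : 'rV[C]_a -> 'rV[C]_b) x : differentiable F x ->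
  mdiff F x (lin1_mx ('d F x)).
Proof.
move=> /differentiable_fdiff h e e0; have [d d0 hd] := h e e0.
by exists d => // u /hd; rewrite mul_rV_lin1.
Qed.

Lemma mdiff_coord a b (F : 'rV[C]_a -> 'rV[C]_b) x (J : 'M[C]_(a, b)) :
  (forall k, fdiff (fun y => F y 0 k) x (fun u => (u *m J) 0 k)) -> mdiff F x J.
Proof.
move=> h e e0.
have [d hd] := choice (fun k => let: ex_intro2 d p q := h k e e0 in ex_intro _ d (conj p q)).
have [|r r0 hr] := @finite_min _ d; first by move=> k; have [] := hd k.
exists r => // u ur; apply: nrm_rV => [|k]; first by rewrite mulr_ge0 ?nrm_ge0 // ltW.
by have [_ q] := hd k; rewrite !entryB; apply: q; apply: lt_le_trans ur (hr k).
Qed.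

Lemma coord_mdiff a b (F : 'rV[C]_a -> 'rV[C]_b) x (J : 'M[C]_(a, b)) k :
  mdiff F x J -> fdiff (fun y => F y 0 k) x (fun u => (u *m J) 0 k).
Proof.
move=> h e e0; have [d d0 hd] := h e e0; exists d => // u /hd.
by apply: le_trans; rewrite -!entryB; exact: nrm_entry.
Qed.

Lemma fdiff_affine (V : normedModType C) (c : C) (L : V -> C) x :
  {morph L : u v / u + v} -> fdiff (fun y => c + L y) x L.
Proof.
move=> LD e e0; exists 1 => // u _.
have -> : c + L (x + u) - (c + L x) - L u = 0 by rewrite LD; ring.
by rewrite nrm0 mulr_ge0 ?nrm_ge0 // ltW.
Qed.

End Differentials.

(** * Gale duality and the differential of the parametrization *)

Section GaleDuality.
Variables (R : realType) (n N m : nat).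
Local Open Scope complex_scope.
Local Notation C := R[i].
Variables (A : 'M[R]_(1 + n, N)) (B : 'M[R]_(N, m)).
Hypotheses (hN : N = (1 + n + m)%N) (hA : point_configuration A) (hB : gale_dual A B).

Definition configC : 'M[C]_(1 + n, N) := map_mx (real_complex R) A.

Lemma configCE : configC = col_mx (const_mx 1) (AhatC A).
Proof.
rewrite /configC -{1}[A]vsubmxK map_col_mx; have [_ ->] := hA.
by congr col_mx; apply/matrixP => i j; rewrite !mxE.
Qed.

(** The image of [B] lies in the kernel of [A] and both have dimension m = N - (n + 1); ranks do not
    change from the reals to the complex numbers. *)
Lemma gale_kernel (y : 'rV[C]_N) : \sum_k y 0 k = 0 -> y *m (AhatC A)^T = 0 ->
  exists t, y = t *m (galeC B)^T.
Proof.
move=> y1 y2; apply/submxP.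
have yK : (y <= kermx configC^T)%MS.
  apply/sub_kermxP; rewrite configCE tr_col_mx mul_mx_row y2.
  rewrite (_ : y *m _ = 0) ?row_mx0 //.
  by apply/matrixP => i j; rewrite !mxE -[RHS]y1 (ord1 i); apply: eq_bigr => k _; rewrite !mxE mulr1.
have BK : ((galeC B)^T <= kermx configC^T)%MS.
  apply/sub_kermxP; rewrite -trmx_mul /configC /galeC -map_mxM.
  by have [_ ->] := hB; rewrite map_mx0 trmx0.
apply: submx_trans yK _; rewrite -(mxrank_leqif_sup BK) mxrank_ker !mxrank_tr !mxrank_map.
by have [-> _] := hA; have [-> _] := hB; rewrite hN addKn.
Qed.

Lemma gale_relations (t : 'rV[C]_m) :
  \sum_k (t *m (galeC B)^T) 0 k = 0 /\ t *m (galeC B)^T *m (AhatC A)^T = 0.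
Proof.
have : t *m (galeC B)^T *m configC^T = 0.
  rewrite -mulmxA -trmx_mul /configC /galeC -map_mxM.
  by have [_ ->] := hB; rewrite map_mx0 trmx0 mulmx0.
rewrite configCE tr_col_mx mul_mx_row -[0]row_mx0 => /eq_row_mx[h1 h2]; split=> //.
have h0 : (t *m (galeC B)^T *m (const_mx 1 : 'M[C]_(1, N))^T) 0 0 = 0 by rewrite h1 mxE.
by rewrite -[RHS]h0 mxE; apply: eq_bigr => k _; rewrite ![X in _ * X]mxE mulr1.
Qed.

(** Together with the row of ones, this would be a linear relation between the independent rows of
    [A]. *)
Lemma alpha_const_eq0 (w : 'rV[C]_n) (a : C) : (forall k, (w *m AhatC A) 0 k = a) -> w = 0.
Proof.
move=> wa; have fr : row_free configC by rewrite /row_free mxrank_map; have [-> _] := hA.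
have : row_mx (const_mx (- a)) w *m configC = 0.
  rewrite configCE mul_row_col; apply/rowP => k; rewrite mxE wa !mxE.
  by rewrite big_ord1 !mxE mulr1 addNr.
by move=> /eqP; rewrite (mul_mx_rowfree_eq0 _ fr) => /eqP; rewrite -row_mx0 => /eq_row_mx[].
Qed.

Definition gram (t : 'rV[C]_m) : 'M[C]_n :=
  AhatC A *m diag_mx (t *m (galeC B)^T) *m (AhatC A)^T.

Lemma det_gram t : \det (gram t) = cuspidal_form A B t.
Proof.
rewrite /gram det_weighted_gram; apply: eq_bigr => s _; congr (_ * _).
by apply: eq_bigr => k _; rewrite gale_formE.
Qed.

Lemma hessian_horn (om : 'rV[C]_n) t : hessian A (horn_kapranov A B om t) (- om) = gram t.
Proof.
rewrite hessianE /gram; congr (_ *m diag_mx _ *m _); apply/rowP => k.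
rewrite mxE [X in X * _]mxE -gale_formE alpha_formN -[- 1 - _]opprD.
by rewrite mulrAC expCNK mul1r.
Qed.

Definition param (x : 'rV[C]_(n + m)) := horn_kapranov A B (lsubmx x) (rsubmx x).

Definition scale_row (om : 'rV[C]_n) : 'rV[C]_N := \row_k expC (1 + alpha_form A k om).

(** The first [n] rows are the derivatives in omega, the others those in t; the exponentials common
    to each column are factored out on the right. *)
Definition jac (x : 'rV[C]_(n + m)) : 'M[C]_(n + m, N) :=
  col_mx (AhatC A *m diag_mx (rsubmx x *m (galeC B)^T)) (galeC B)^T *m diag_mx (scale_row (lsubmx x)).

Lemma jac_entry x u k : (u *m jac x) 0 k = expC (1 + alpha_form A k (lsubmx x)) *
  ((lsubmx u *m AhatC A) 0 k * gale_form B k (rsubmx x) + gale_form B k (rsubmx u)).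
Proof.
rewrite /jac; set M := col_mx _ _; rewrite mulmxA mul_mx_diag [LHS]mxE [scale_row _ 0 k]mxE mulrC /M.
congr (_ * _).
rewrite -{1}[u]hsubmxK mul_row_col mxE mulmxA mul_mx_diag [X in X + _]mxE.
by rewrite !gale_formE.
Qed.

Lemma param_mdiff x : mdiff param x (jac x).
Proof.
apply: mdiff_coord => k.
pose L (y : 'rV[C]_(n + m)) : C := (lsubmx y *m AhatC A) 0 k.
pose G (y : 'rV[C]_(n + m)) : C := gale_form B k (rsubmx y).
have LD : {morph L : u v / u + v} by move=> u v; rewrite /L linearD mulmxDl mxE.
have GD : {morph G : u v / u + v} by move=> u v; rewrite /G !gale_formE linearD mulmxDl mxE.
have [K1 _ hK1] := mulmx_bounded (col_mx (AhatC A) (0 : 'M[C]_(m, N))).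
have [K2 _ hK2] := mulmx_bounded (col_mx (0 : 'M[C]_(n, N)) (galeC B)^T).
have bL u : nrm (L u) <= K1 * nrm u.
  apply: le_trans (hK1 u); rewrite -{2}[u]hsubmxK mul_row_col mulmx0 addr0; exact: nrm_entry.
have bG u : nrm (G u) <= K2 * nrm u.
  apply: le_trans (hK2 u); rewrite -{2}[u]hsubmxK mul_row_col mulmx0 add0r /G gale_formE.
  exact: nrm_entry.
have fL : fdiff (fun y => 1 + L y) x L by exact: fdiff_affine.
have fG : fdiff G x G.
  have := @fdiff_affine _ _ 0 G x GD.
  by rewrite (_ : (fun y => 0 + G y) = G) //; apply/funext => y; rewrite add0r.
have bE w : nrm (expC (1 + L x) * w) <= nrm (expC (1 + L x)) * nrm w by rewrite nrmM.
have EB : {morph (fun w => expC (1 + L x) * w) : u v / u - v} by move=> u v; rewrite mulrBr.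
have fE := fdiff_comp fL (cdiff_expC (1 + L x)) bL bE EB.
have bEL u : nrm (((fun w => expC (1 + L x) * w) \o L) u) <= nrm (expC (1 + L x)) * K1 * nrm u.
  by rewrite /= nrmM -mulrA ler_wpM2l ?nrm_ge0.
have := fdiffM fE fG bEL bG; congr fdiff; apply/funext => u /=.
  by rewrite mxE alpha_formE.
by rewrite jac_entry alpha_formE -/(L x) -/(L u) -/(G x) -/(G u); ring.
Qed.

Lemma param_singular x : (forall k, gale_form B k (rsubmx x) != 0) ->
  discriminant_variety A (param x).
Proof.
move=> gx; split.
  by move=> k; rewrite mxE mulf_neq0 ?expC_neq0.
have cE k : param x 0 k * expC (- 1 + alpha_form A k (- lsubmx x)) = (rsubmx x *m (galeC B)^T) 0 k.
  by rewrite mxE alpha_formN -[- 1 - _]opprD mulrAC expCNK mul1r gale_formE.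
have [g1 g2] := gale_relations (rsubmx x).
have e0 : expsum A (param x) (- 1) (- lsubmx x) = 0.
  by rewrite -[RHS]g1; apply: eq_bigr => k _; rewrite cE.
exists (- 1), (- lsubmx x); split => //; first by rewrite expsum_derive0.
move=> j; rewrite expsum_derive.
have g2j : (rsubmx x *m (galeC B)^T *m (AhatC A)^T) 0 j = 0 by rewrite g2 mxE.
rewrite -[RHS]g2j [RHS]mxE; apply: eq_bigr => k _.
by rewrite cE [(AhatC A)^T k j]mxE.
Qed.

(** At a singular point (w0, w) the terms of the exponential sum form a vector of ker A, hence B t.
    Then omega = - w, and rescaling t by exp (-1 - w0) moves the singular point to w0 = -1. *)
Lemma discriminant_param c : discriminant_variety A c ->
  exists x, (forall k, gale_form B k (rsubmx x) != 0) /\ c = param x.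
Proof.
move=> [c0 [w0 [w [s1 _ s3]]]].
pose y : 'rV[C]_N := \row_k (c 0 k * expC (w0 + alpha_form A k w)).
have [t yt] : exists t, y = t *m (galeC B)^T.
  apply: gale_kernel; first by rewrite -[RHS]s1; apply: eq_bigr => k _; rewrite mxE.
  apply/rowP => j; rewrite [RHS]mxE -[RHS](s3 j) expsum_derive [LHS]mxE; apply: eq_bigr => k _.
  by rewrite [y 0 k]mxE [(AhatC A)^T k j]mxE.
have gE k : gale_form B k (expC (- 1 - w0) *: t) = expC (- 1 + alpha_form A k w) * c 0 k.
  rewrite gale_formE -scalemxAl -yt !mxE mulrCA -expCD mulrC; congr (expC _ * _).
  by ring.
exists (row_mx (- w) (expC (- 1 - w0) *: t)); split.
  by move=> k; rewrite row_mxKr gE mulf_neq0 ?expC_neq0.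
apply/rowP => k; rewrite mxE row_mxKr gE row_mxKl alpha_formN mulrA -expCD.
by rewrite (_ : 1 - _ + _ = 0) ?expC0 ?mul1r //; ring.
Qed.

(** The variation of the coefficients caused by [w] then lies in ker A, hence in the image of [B],
    and a variation of t compensates it. *)
Lemma gram_kernel_jac (x : 'rV[C]_(n + m)) (w : 'rV[C]_n) : w *m gram (rsubmx x) = 0 ->
  exists t, row_mx w t *m jac x = 0.
Proof.
move=> wH; set g := rsubmx x *m (galeC B)^T.
have [g1 g2] := gale_relations (rsubmx x).
have [||t ht] := @gale_kernel (w *m AhatC A *m diag_mx g).
- have h0 : (g *m (AhatC A)^T *m w^T) 0 0 = 0 by rewrite g2 mul0mx mxE.
  rewrite -[RHS]h0 -[in RHS]mulmxA -trmx_mul [RHS]mxE; apply: eq_bigr => k _.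
  by rewrite mul_mx_diag [LHS]mxE [((w *m AhatC A)^T) k 0]mxE mulrC.
- by rewrite -[RHS]wH /gram !mulmxA.
exists (- t); rewrite mulmxA mul_row_col mulmxA ht mulNmx subrr mul0mx //.
Qed.

(** Without its exponential factors, [v] has coordinate sum 0. Inverting the Gram matrix gives the
    [w] whose contribution has the same product with [(AhatC A)^T]; the remainder lies in ker A and
    comes from t. *)
Lemma jac_image (x : 'rV[C]_(n + m)) (v : 'rV[C]_N) : gram (rsubmx x) \in unitmx ->
  \sum_k v 0 k * expC (- (1 + alpha_form A k (lsubmx x))) = 0 -> exists u, v = u *m jac x.
Proof.
move=> Hu v0; pose y : 'rV[C]_N := \row_k (v 0 k * expC (- (1 + alpha_form A k (lsubmx x)))).
set g := rsubmx x *m (galeC B)^T.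
pose w := y *m (AhatC A)^T *m invmx (gram (rsubmx x)).
have [g1 g2] := gale_relations (rsubmx x).
have [||t ht] := @gale_kernel (y - w *m AhatC A *m diag_mx g).
- under eq_bigr do rewrite entryB.
  rewrite sumrB; have -> : \sum_k y 0 k = 0 by rewrite -[RHS]v0; apply: eq_bigr => k _; rewrite mxE.
  have h : (g *m (AhatC A)^T *m w^T) 0 0 = 0 by rewrite g2 mul0mx mxE.
  rewrite sub0r; apply/eqP; rewrite oppr_eq0; apply/eqP; rewrite -[RHS]h.
  rewrite -[in RHS]mulmxA -trmx_mul [RHS]mxE; apply: eq_bigr => k _.
  by rewrite mul_mx_diag [LHS]mxE [((w *m AhatC A)^T) k 0]mxE mulrC.
- rewrite mulmxBl.
  have -> : w *m AhatC A *m diag_mx g *m (AhatC A)^T = w *m gram (rsubmx x).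
    by rewrite /gram !mulmxA.
  by rewrite /w mulmxKV // subrr.
exists (row_mx w t); rewrite mulmxA mul_row_col mulmxA -ht addrC subrK.
apply/rowP => k; rewrite mul_mx_diag !mxE -mulrA [expC (- _) * _]mulrC expCNK mulr1 //.
Qed.

End GaleDuality.

(** * Smooth points of the discriminant *)

Lemma cross_difference (K : comPzRingType) (a b x x' y y' : K) : a * x' = b * y' ->
  a * x - b * y = b * (y' - y) - a * (x' - x).
Proof. by move=> e; rewrite !mulrBr e; ring. Qed.

(** The hypothesis is the product rule for E_l D_k - E_k D_l when both D have derivative 0. *)
Lemma cross_derivative (K : comPzRingType) (a b c d x y p q : K) :
  a * - c * x + p * 0 - (b * - d * y + q * 0) = 0 -> c * a * x = d * b * y.
Proof.
rewrite !mulr0 !addr0 !mulrN !mulNr opprK addrC => /eqP; rewrite subr_eq0 => /eqP h.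
by rewrite [c * a]mulrC [d * b]mulrC.
Qed.

Section Chart.
Variables (R : realType).
Local Open Scope complex_scope.
Local Notation C := R[i].

(** The determinant is a polynomial in s that does not vanish at s = 1; among r/2, r/3, ..., taken
    in a number exceeding its degree, one is not a root. *)
Lemma det_pencil_dense k (H0 H1 : 'M[C]_k) : \det (H0 + H1) != 0 ->
  forall r : R, 0 < r -> exists2 s : C, nrm s < r & \det (H0 + s *: H1) != 0.
Proof.
move=> d1 r r0.
pose P : 'M[{poly C}]_k := map_mx polyC H0 + 'X *: map_mx polyC H1.
have PE s : (\det P).[s] = \det (H0 + s *: H1).
  rewrite -[LHS]/(horner_eval s (\det P)) -det_map_mx; congr (\det _).
  apply/matrixP => i j; rewrite /P !mxE.
  by rewrite -[LHS]/(((H0 i j)%:P + 'X * (H1 i j)%:P).[s]) !hornerE.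
have P0 : \det P != 0.
  by apply: contraNneq d1 => P0; rewrite -[H1]scale1r -PE P0 horner0.
pose s i : C := (r / i.+2%:R)%:C.
pose rs := [seq s i | i <- iota 0 (size (\det P))].
have [/allP ar|/allPn[x /mapP[i _ ->] nx]] := boolP (all (root (\det P)) rs).
  have := max_poly_roots P0 (introT allP ar); rewrite size_map size_iota ltnn.
  move=> h; have /h // : uniq rs.
  rewrite map_inj_uniq ?iota_uniq // => i j /complexI /(mulfI (lt0r_neq0 r0)) /invr_inj.
  by move=> /eqP; rewrite eqr_nat => /eqP[].
exists (s i); last by rewrite -PE.
rewrite nrm_real ger0_norm ?divr_ge0 ?(ltW r0) // ltr_pdivrMr ?ltr0n //.
by rewrite ltr_pMr // ltr1n.
Qed.

Variables (n m : nat).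
Local Notation N := (n + m).+1.
Variables (A : 'M[R]_(1 + n, N)) (B : 'M[R]_(N, m)).
Hypotheses (n0 : (0 < n)%N) (hA : point_configuration A) (hB : gale_dual A B).
Variables (U0 U V : set 'rV[C]_N) (phi psi : 'rV[C]_N -> 'rV[C]_N) (f : 'rV[C]_N).
Local Notation S := (discriminant_variety A).
Hypotheses (oU0 : open U0) (oU : open U) (oV : open V) (fU0 : U0 f) (fU : U f) (fS : S f).
Hypothesis hbi : biholomorphic U V phi psi.
Hypothesis hS : forall x, U x -> ((S `&` U0) x <-> phi x 0 ord_max = 0).

Let hN : N = (1 + n + m)%N. Proof. by []. Qed.
Let O := U `&` U0.

Let oO : open O. Proof. exact: openI. Qed.

(** In the chart, forgetting the last coordinate identifies the hypersurface with an open piece of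
    the source space of [param]; the transpose puts back a 0. *)
Definition drop_last : 'M[C]_(N, n + m) := \matrix_(i, j) (i == lift ord_max j)%:R.

Lemma drop_last_entry (x : 'rV[C]_N) j : (x *m drop_last) 0 j = x 0 (lift ord_max j).
Proof.
rewrite mxE (bigD1 (lift ord_max j)) //= big1 ?addr0.
  by rewrite mxE eqxx mulr1.
by move=> i ij; rewrite mxE (negbTE ij) mulr0.
Qed.

Lemma drop_lastK (y : 'rV[C]_(n + m)) : y *m drop_last^T *m drop_last = y.
Proof.
apply/rowP => j; rewrite drop_last_entry mxE (bigD1 j) //= big1 ?addr0.
  by rewrite !mxE eqxx mulr1.
move=> i ij; rewrite !mxE (inj_eq (@lift_inj _ _)) eq_sym (negbTE ij) mulr0 //.
Qed.

Lemma drop_last_tr_max (y : 'rV[C]_(n + m)) : (y *m drop_last^T) 0 ord_max = 0.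
Proof.
by rewrite mxE big1 // => j _; rewrite !mxE (negbTE (neq_lift _ _)) mulr0.
Qed.

Let dphi x := lin1_mx ('d phi x).

Lemma phi_mdiff x : U x -> mdiff phi x (dphi x).
Proof. by have [h _ _ _] := hbi; move=> /h; exact: differentiable_mdiff. Qed.

Lemma phi_max x : O x -> S x <-> phi x 0 ord_max = 0.
Proof.
move=> [xU xU0]; have [h1 h2] := hS xU; split => [xS|/h2[] //].
by apply: h1; split.
Qed.

Lemma param_O (x : 'rV[C]_(n + m)) : O (param A B x) ->
  exists2 d : R, 0 < d & forall y, nrm (y - x) < d -> O (param A B y).
Proof.
move=> /(open_nrm oO)[e e0 he]; have [d d0 hd] := mdiff_cont (param_mdiff A B x) e0.
exists d => // y /hd; rewrite [x + _]addrC subrK; exact: he.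
Qed.

Lemma gram_nondegenerate : exists t, \det (gram A B t) != 0.
Proof.
apply: contrapT => no.
have H0 t : \det (gram A B t) = 0.
  by apply/eqP; apply: contrapT => /negP h; apply: no; exists t.
pose Om := [set x | O (param A B x)].
pose G x := phi (param A B x) *m drop_last.
pose J x := jac A B x *m dphi (param A B x) *m drop_last.
pose z0 := phi f.
have [_ hpsi pU pV] := hbi.
have [Vz fz] := pU _ fU.
have Of : O f by split.
have z0max : z0 0 ord_max = 0 by apply/(phi_max Of).
have [r1 r10 hr1] := open_nrm oV Vz.
have [r2 r20 hr2] : exists2 r : R, 0 < r & forall z, nrm (z - z0) < r -> O (psi z).
  have [e e0 he] := open_nrm oO Of.
  have [d d0 hd] := mdiff_cont (differentiable_mdiff (hpsi _ Vz)) e0.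
  exists d => // z /hd; rewrite [phi f + _]addrC subrK fz; exact: he.
have [K K0 hK] := mulmx_bounded drop_last^T.
(* [K] bounds the lift by the transpose of [drop_last], so that a point within [r] lifts to one
   within r1 and r2 of [z0]. *)
pose r := Num.min r1 r2 / (K + 2).
have r12 : 0 < Num.min r1 r2 by rewrite lt_min r10.
have K2 : 0 < K + 2 by lra.
have r0 : 0 < r by rewrite divr_gt0.
have [||||y ynear yout] := @singular_image_misses R (n + m) Om G J _ _ _ _ (z0 *m drop_last) r r0.
- by rewrite addn_gt0 n0.
- by move=> x; exact: param_O.
- move=> x [xU _].
  have h := mdiff_comp (param_mdiff A B x) (phi_mdiff xU).
  exact: (mdiff_comp h (mdiff_mulmx _ _)).
- move=> x _; have /eqP/det0P[w w0 wH] := H0 (rsubmx x).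
  have [t ht] := gram_kernel_jac hN hA hB wH.
  apply/eqP/det0P; exists (row_mx w t).
    by apply: contra_neq w0 => /eqP; rewrite -row_mx0 => /eqP/eq_row_mx[].
  have -> : row_mx w t *m J x = (row_mx w t *m jac A B x) *m (dphi (param A B x) *m drop_last).
    by rewrite /J; move: (jac A B x) => M; rewrite !mulmxA.
  by rewrite ht mul0mx.
(* The missed point [y] is lifted to the slice where the last coordinate vanishes; its image under
   [psi] lies in the discriminant, hence has a preimage under [param], a contradiction. *)
pose z := z0 + (y - z0 *m drop_last) *m drop_last^T.
have zz0 : z - z0 = (y - z0 *m drop_last) *m drop_last^T by rewrite /z addrAC subrr add0r.
have znear : nrm (z - z0) < Num.min r1 r2.
  rewrite zz0; apply: le_lt_trans (hK _) _.
  have : K * nrm (y - z0 *m drop_last) <= K * r by rewrite ler_wpM2l.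
  have : (K + 2) * r = Num.min r1 r2 by rewrite /r mulrC divfK // gt_eqF.
  by lra.
move: znear; rewrite lt_min => /andP[/hr1 Vz' /hr2 Oz'].
have [Uz' phiz] := pV _ Vz'.
have zmax : z 0 ord_max = 0 by rewrite mxE z0max drop_last_tr_max addr0.
have /(discriminant_param hN hA hB)[x [gx px]] : S (psi z).
  by apply/(phi_max Oz'); rewrite phiz.
apply: (yout x); first by rewrite /Om /= -px.
by rewrite /G -px phiz /z mulmxDl drop_lastK addrC subrK.
Qed.

(** The gradient at [p] of the local equation F, the last coordinate of [phi]. *)
Let D (p : 'rV[C]_N) k : C := dphi p k ord_max.

Lemma dphi_row p k : ((delta_mx 0 k : 'rV[C]_N) *m dphi p) 0 ord_max = D p k.
Proof. by rewrite -rowE mxE. Qed.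

Lemma dphi_lipschitz : exists K s : R, [/\ 0 <= K, 0 < s & forall p u, nrm (p - f) < s ->
  nrm u < s -> forall k, nrm (D (p + u) k - D p k) <= K * nrm u].
Proof.
have [r r0 hr] := open_nrm oU fU.
have [|K [s [K0 s0 hK]]] := @mdiff_taylor _ _ _ phi dphi f r r0.
  by move=> x /hr; exact: phi_mdiff.
exists K, s; split=> // p u hp hu k; have [_ h _] := hK p u hp hu.
have d1 : nrm (delta_mx 0 k : 'rV[C]_N) <= 1.
  apply: nrm_rV => // j; rewrite mxE eqxx /=; case: (j == k); last by rewrite nrm0.
  by rewrite -(rmorph1 (real_complex R)) nrm_real normr1.
have := h (delta_mx 0 k); rewrite -!dphi_row => q.
rewrite -entryB; apply: le_trans (nrm_entry _ _) (le_trans q _).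
by rewrite -[leRHS]mulr1 ler_wpM2l // mulr_ge0 ?nrm_ge0.
Qed.

(** Differentiating psi o phi = id makes [dphi f] invertible, so that its last column is not
    zero. *)
Lemma dphi_last_neq0 : exists k, D f k != 0.
Proof.
have [_ hpsi pU _] := hbi; have [Vz fz] := pU _ fU.
have [r r0 hr] := open_nrm oU fU.
pose L := lin1_mx ('d psi (phi f)).
have h : dphi f *m L = 1%:M.
  apply/row_matrixP => i; rewrite !rowE.
  apply: (@fdiff_eq_near _ _ _ (psi \o phi) (mulmx^~ 1%:M) f (mulmx^~ (dphi f *m L)) (mulmx^~ 1%:M) r r0).
  - move=> u hu; have Uu : U (f + u) by apply: hr; rewrite addrAC subrr add0r.
    by have [_] := pU _ Uu; rewrite mulmx1.
  - exact: mdiff_comp (phi_mdiff fU) (differentiable_mdiff (hpsi _ Vz)).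
  - exact: mdiff_mulmx.
  - by move=> a u; rewrite scalemxAl.
  - by move=> a u; rewrite scalemxAl.
apply: contrapT => no; have D0 k : D f k = 0.
  by apply/eqP; apply: contrapT => /negP h0; apply: no; exists k.
have := congr1 (fun M : 'M[C]_N => M ord_max ord_max) (mulmx1C h).
rewrite !mxE eqxx big1 => [/eqP|k _]; first by rewrite eq_sym oner_eq0.
by rewrite -[X in _ * X]/(D f k) D0 mulr0.
Qed.

Variable x0 : 'rV[C]_(n + m).
Hypotheses (px0 : param A B x0 = f) (gx0 : forall k, gale_form B k (rsubmx x0) != 0).

Lemma near_x0 : exists2 d : R, 0 < d & forall x, nrm (x - x0) < d ->
  O (param A B x) /\ phi (param A B x) 0 ord_max = 0.
Proof.
have [|d1 d10 h1] := @param_O x0; first by rewrite px0.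
have [K K0 hK] := mulmx_bounded (col_mx (0 : 'M[C]_(n, N)) (galeC B)^T).
have K1 : 0 < K + 1 by lra.
have [|e e0 he] := @finite_min R _ (fun k => nrm (gale_form B k (rsubmx x0))).
  by move=> k; exact: nrm_gt0.
exists (Num.min d1 (e / (K + 1))); first by rewrite lt_min d10 divr_gt0.
move=> x; rewrite lt_min ltr_pdivlMr // => /andP[/h1 Ox xe]; split=> //.
apply/(phi_max Ox)/(param_singular hA hB) => k.
have q : nrm (gale_form B k (rsubmx x) - gale_form B k (rsubmx x0)) < e.
  rewrite !gale_formE -entryB -mulmxBl -linearB /=.
  apply: le_lt_trans (nrm_entry _ _) _; apply: le_lt_trans xe.
  have := hK (x - x0); rewrite -{1}[x - x0]hsubmxK mul_row_col mulmx0 add0r.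
  by have := nrm_ge0 (x - x0); lra.
apply: contraTneq (he k) => g0; rewrite -ltNge.
by move: q; rewrite g0 sub0r nrmN.
Qed.

(** The conormal of the hyperplane of those c whose exponential sum vanishes at (-1, -omega). It
    depends on x through omega alone. *)
Let E k (x : 'rV[C]_(n + m)) : C := expC (- (1 + alpha_form A k (lsubmx x))).

Lemma tangent_generic x (d : R) : 0 < d ->
  (forall y, nrm (y - x) < d -> O (param A B y) /\ phi (param A B y) 0 ord_max = 0) ->
  \det (gram A B (rsubmx x)) != 0 ->
  forall k l, E l x * D (param A B x) k = E k x * D (param A B x) l.
Proof.
move=> d0 hd gx k l; have [|[xU _] _] := hd x; first by rewrite subrr nrm0.
have tg (u : 'rV[C]_(n + m)) : (u *m (jac A B x *m dphi (param A B x))) 0 ord_max = 0.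
  refine (@fdiff_eq_near _ _ _ (fun y => phi (param A B y) 0 ord_max) (fun=> 0) x
    (fun u : 'rV[C]_(n + m) => (u *m (jac A B x *m dphi (param A B x))) 0 ord_max) (fun=> 0) d d0 _ _ _ _ _ u).
  - by move=> v hv; have [|_ ->] := hd (x + v); rewrite // addrAC subrr add0r.
  - exact: coord_mdiff (mdiff_comp (param_mdiff A B x) (phi_mdiff xU)).
  - by move=> e e0; exists 1 => // v _; rewrite !subr0 nrm0 mulr_ge0 ?nrm_ge0 // ltW.
  - by move=> a v; rewrite -scalemxAl mxE.
  - by move=> a v; rewrite scaler0.
(* Such vectors span the hyperplane annihilated by E; dF kills each of them exactly when the
   relation for [k] and [l] holds. *)
pose v : 'rV[C]_N := E l x *: delta_mx 0 k - E k x *: delta_mx 0 l.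
have [||u vu] := @jac_image _ _ _ _ A B hN hA hB x v.
- by rewrite unitmxE unitfE.
- have dE j : \sum_i (delta_mx 0 j : 'rV[C]_N) 0 i * E i x = E j x.
    rewrite (bigD1 j) //= big1 ?addr0; first by rewrite mxE !eqxx mul1r.
    by move=> i ij; rewrite mxE eqxx (negbTE ij) mul0r.
  transitivity (E l x * E k x - E k x * E l x); last by rewrite mulrC subrr.
  rewrite -[in E l x * E k x](dE k) -[in E k x * E l x](dE l) !mulr_sumr -sumrB.
  by apply: eq_bigr => i _; rewrite /v entryB !entryZ mulrBl -!mulrA.
have := tg u; rewrite mulmxA -vu /v mulmxBl -!scalemxAl entryB !entryZ !dphi_row.
by move/eqP; rewrite subr_eq0 => /eqP.
Qed.

Lemma gram_add t u : gram A B (t + u) = gram A B t + gram A B u.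
Proof. by rewrite /gram mulmxDl linearD /= mulmxDr mulmxDl. Qed.

Lemma gram_scale a t : gram A B (a *: t) = a *: gram A B t.
Proof. by rewrite /gram -scalemxAl linearZ /= -scalemxAr -scalemxAl. Qed.

Lemma tangent_near : exists2 d : R, 0 < d & forall x, nrm (x - x0) < d ->
  forall k l, E l x * D (param A B x) k = E k x * D (param A B x) l.
Proof.
have [d1 d10 h1] := near_x0; have [K [s [K0 s0 hK]]] := dphi_lipschitz.
have [d2 d20 h2] := mdiff_cont (param_mdiff A B x0) s0.
exists (Num.min d1 d2); first by rewrite lt_min d10.
move=> x; rewrite lt_min => /andP[x1 x2] k l.
have xs : nrm (param A B x - f) < s by rewrite -px0; have := h2 _ x2; rewrite [x0 + _]addrC subrK.
apply/eqP; rewrite -subr_eq0; apply/eqP/nrm0_eq0/le_anti; rewrite nrm_ge0 andbT.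
apply/ler_addgt0Pr => e e0; rewrite add0r.
have M0 : 0 < (nrm (E l x) + nrm (E k x)) * K + 1.
  have : 0 <= (nrm (E l x) + nrm (E k x)) * K by rewrite mulr_ge0 // addr_ge0 ?nrm_ge0.
  lra.
pose eta := Num.min s (e / ((nrm (E l x) + nrm (E k x)) * K + 1)).
have eta0 : 0 < eta by rewrite lt_min s0 divr_gt0.
have [d3 d30 h3] := mdiff_cont (param_mdiff A B x) eta0.
have [t1 gt1] := gram_nondegenerate.
(* Only t moves, towards a nondegenerate [t1]: E is unchanged, and the change of D is controlled by
   its Lipschitz bound. *)
pose v : 'rV[C]_(n + m) := row_mx 0 (t1 - rsubmx x).
have v0 : 0 < nrm v + 1 by have := nrm_ge0 v; lra.
pose rho := Num.min d3 (d1 - nrm (x - x0)).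
have rho0 : 0 < rho by rewrite lt_min d30 subr_gt0.
have [|c hc gc] := @det_pencil_dense _ (gram A B (rsubmx x)) (gram A B (t1 - rsubmx x)) _
    (rho / (nrm v + 1)) (divr_gt0 rho0 v0).
  by rewrite -gram_add addrC subrK.
have cv : nrm (c *: v) < rho.
  rewrite nrmZ; apply: (@le_lt_trans _ _ (nrm c * (nrm v + 1))).
    by rewrite ler_wpM2l ?nrm_ge0 //; lra.
  by rewrite -ltr_pdivlMr.
move: cv; rewrite lt_min => /andP[cv3 cv1].
have lx : lsubmx (x + c *: v) = lsubmx x.
  by rewrite linearD linearZ /= row_mxKl scaler0 addr0.
have rx : rsubmx (x + c *: v) = rsubmx x + c *: (t1 - rsubmx x).
  by rewrite linearD linearZ /= row_mxKr.
have dx' : 0 < d1 - nrm (x - x0) - nrm (c *: v) by lra.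
have := @tangent_generic (x + c *: v) _ dx' _ _ k l.
rewrite rx gram_add gram_scale gc /E lx => /(_ _ isT) tg.
have {}tg : E l x * D (param A B (x + c *: v)) k = E k x * D (param A B (x + c *: v)) l.
  apply: tg => y hy; apply: h1.
  have -> : y - x0 = (y - (x + c *: v)) + (c *: v) + (x - x0).
    by rewrite opprD !addrA !subrK.
  apply: le_lt_trans (nrmD _ _) _; have := nrmD (y - (x + c *: v)) (c *: v); lra.
have := h3 _ cv3; set w := param A B (x + c *: v) - param A B x; rewrite lt_min => /andP[ws we].
have wE : param A B (x + c *: v) = param A B x + w by rewrite /w [RHS]addrC subrK.
rewrite wE in tg.
have -> : E l x * D (param A B x) k - E k x * D (param A B x) l =
    E k x * (D (param A B x + w) l - D (param A B x) l) -
    E l x * (D (param A B x + w) k - D (param A B x) k).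
  exact: cross_difference.
apply: le_trans (nrmD _ _) _; rewrite nrmN (nrmM (E k x)) (nrmM (E l x)).
have q1 := ler_wpM2l (nrm_ge0 (E k x)) (hK _ _ xs ws l).
have q2 := ler_wpM2l (nrm_ge0 (E l x)) (hK _ _ xs ws k).
apply: le_trans (lerD q1 q2) _; move: we; rewrite ltr_pdivlMr // => /ltW h; apply: le_trans h.
have W0 := nrm_ge0 w; rewrite -mulrDl mulrA [leRHS]mulrC ler_wpM2r //.
by rewrite [nrm (E k x) + _]addrC lerDl.
Qed.

Lemma gram_unit_x0 : \det (gram A B (rsubmx x0)) != 0.
Proof.
apply/negP => /det0P[w w0 wH].
have [t ht] := gram_kernel_jac hN hA hB wH.
pose v := row_mx w t; pose a k := alpha_form A k w.
have [d d0 hd] := tangent_near.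
have [K [s [K0 s0 hK]]] := dphi_lipschitz.
pose Dl k (c : C) := D (param A B (x0 + c *: v)) k.
(* E along the line x0 + c v, in the form to which [cdiff_expC_line] applies. *)
pose El k (c : C) := 1 * expC (- (1 + alpha_form A k (lsubmx x0)) + c * (- a k)).
have ElE k c : El k c = E k (x0 + c *: v).
  have lE : lsubmx (x0 + c *: v) = lsubmx x0 + c *: w by rewrite linearD linearZ /= row_mxKl.
  rewrite /El /E mul1r lE; congr expC; rewrite /a !alpha_formE mulmxDl -scalemxAl.
  by rewrite entryD entryZ mulrN -opprD addrA.
have dE k : cdiff (El k) 0 (E k x0 * - a k).
  by have := cdiff_expC_line 1 (- (1 + alpha_form A k (lsubmx x0))) (- a k); rewrite [1 * expC _]mul1r.
have E0 k : El k 0 = E k x0 by rewrite ElE scale0r addr0.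
have D0 k : Dl k 0 = D f k by rewrite /Dl scale0r addr0 px0.
(* As [v] is in the kernel of the differential, [param] moves by o(c) and the Lipschitz bound makes
   the change of D o(c) as well. *)
have dD k : cdiff (Dl k) 0 0.
  have V0 := nrm_ge0 v.
  have M0 : 0 < K * nrm v + 1 by have := mulr_ge0 K0 V0; lra.
  have [d2 d20 h2] := mdiff_cont (param_mdiff A B x0) s0.
  move=> e e0; have [d1 d10 h1] := param_mdiff A B x0 (divr_gt0 e0 M0).
  have V1 : 0 < nrm v + 1 by lra.
  have dd0 : 0 < Num.min d1 d2 by rewrite lt_min d10.
  exists (Num.min d1 d2 / (nrm v + 1)); first by rewrite divr_gt0.
  move=> c; rewrite ltr_pdivlMr // => hc.
  have cv : nrm (c *: v) < Num.min d1 d2.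
    by rewrite nrmZ; apply: le_lt_trans hc; rewrite ler_wpM2l ?nrm_ge0 //; lra.
  move: cv; rewrite lt_min => /andP[/h1 k1 /h2 k2].
  rewrite -scalemxAl ht scaler0 subr0 px0 in k1; rewrite px0 in k2.
  rewrite add0r mul0r subr0 D0 /Dl.
  have := hK f (param A B (x0 + c *: v) - f) _ k2 k; rewrite subrr nrm0 => /(_ s0).
  rewrite [f + _]addrC subrK => q; apply: le_trans q _.
  apply: le_trans (ler_wpM2l K0 k1) _; rewrite nrmZ.
  have -> : K * (e / (K * nrm v + 1) * (nrm c * nrm v)) =
      e * nrm c * ((K * nrm v) / (K * nrm v + 1)) by field; rewrite gt_eqF.
  rewrite -[leRHS]mulr1 ler_wpM2l ?mulr_ge0 ?nrm_ge0 ?(ltW e0) //.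
  by rewrite ler_pdivrMr //; lra.
have key k l : a l * E l x0 * Dl k 0 = a k * E k x0 * Dl l 0.
  have V1 : 0 < nrm v + 1 by have := nrm_ge0 v; lra.
  have r0 : 0 < d / (nrm v + 1) by rewrite divr_gt0.
  have dZ := cdiffB (cdiffM (dE l) (dD k)) (cdiffM (dE k) (dD l)).
  have hZ c : nrm c < d / (nrm v + 1) -> El l c * Dl k c - El k c * Dl l c = 0.
    rewrite ltr_pdivlMr // => hc; rewrite (ElE l) (ElE k) /Dl hd ?subrr //.
    rewrite addrAC subrr add0r nrmZ; apply: le_lt_trans hc.
    by rewrite ler_wpM2l ?nrm_ge0 //; lra.
  exact: (cross_derivative (cdiff_zero_near r0 hZ dZ)).
have [k Dk] := dphi_last_neq0.
(* The differentiated relation is divided by the relation itself at x0, whose common value is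
   nonzero because [D f k] is. *)
have al l : a l = a k.
  have tg : E l x0 * D f k = E k x0 * D f l.
    by have := hd x0 _ k l; rewrite subrr nrm0 px0 => /(_ d0).
  have := key k l; rewrite (D0 k) (D0 l) -[a l * _ * _]mulrA -[a k * _ * _]mulrA -tg => /mulIf; apply.
  by rewrite mulf_neq0 ?expC_neq0.
suff : w = 0 by move/eqP; rewrite (negbTE w0).
by apply: (alpha_const_eq0 hA (a := a k)) => l; rewrite -alpha_formE -/(a l) al.
Qed.

End Chart.

Theorem theorem3p5 (R : realType) (n N m : nat)
    (hn : (1 <= n)%N) (hm : m = (N - n - 1)%N) (hm1 : (1 <= m)%N)
    (A : 'M[R]_(1 + n, N)) (hA : point_configuration A)
    (B : 'M[R]_(N, m)) (hB : gale_dual A B)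
    (omega : 'rV[R[i]]_n) (t : 'rV[R[i]]_m) (ht : gale_complement B t)
    (f : 'rV[R[i]]_N) (hf : f = horn_kapranov A B omega t) :
  (hessian A f (- omega) \notin unitmx <-> cuspidal_form A B t = 0) /\
  (is_hypersurface (discriminant_variety A) ->
   smooth_point (discriminant_variety A) f ->
   hessian A f (- omega) \in unitmx).
Proof.
have NE : N = (n + m).+1 by lia.
have HE : hessian A f (- omega) = gram A B t by rewrite hf hessian_horn.
rewrite HE unitmxE unitfE det_gram negbK; split; first by split=> /eqP.
move=> _ [Sf [U0 [oU0 fU0 sub]]].
(* With [N] equal to [(n + m).+1], [N.-1] computes to [n + m] and [ord_max] is the one coordinate
   that has to vanish in the chart. *)
move: NE => {}hm; subst N.
rewrite -det_gram.
have [|U [V [phi [psi [oU oV fU bi chart]]]]] := sub f; first by split.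
pose x0 : 'rV[R[i]]_(n + m) := row_mx omega t.
have rx : rsubmx x0 = t by rewrite row_mxKr.
rewrite -rx.
apply: (gram_unit_x0 hn hA hB oU0 oU oV fU0 fU Sf bi) => [x xU||k].
- rewrite (chart x xU); split => [h|h k kN]; first exact: h.
  suff -> : k = ord_max by [].
  by apply/val_inj/eqP; rewrite /= eqn_leq kN andbT -ltnS ltn_ord.
- by rewrite /param row_mxKl row_mxKr.
- by rewrite rx; exact: ht.
Qed.
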